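(* Let $\mathsf{S5}_t=\mathsf{S4}_t\oplus(\Diamond p\to\Box\Diamond p)$. Then $\mathsf{PTAB}(\mathsf{S4BP}^{2,\omega}_{2,2})=\{\mathsf{Ga},\mathsf{S5}_t\}\cup\{\mathsf{Log}((\mathfrak{G}_n)^m_\omega),\mathsf{Log}((\breve{\mathfrak{G}_n})^m_\omega):2m<n\in\mathbb{Z}^+\}$.
   Context: Tense formulas use $\Box$ and a past possibility operator written here $\mathsf{P}$; $\mathsf{S4}_t=\mathsf{K}_t\oplus\{\Box p\to p,\Box p\to\Box\Box p\}$. $\mathsf{S4BP}^{2,\omega}_{2,2}$ is $\mathsf{S4}_t$ extended by axioms bounding depth by 2, forth-width by 2 and back-width by 2 (namely $\mathbf{bd}_2=\Diamond(\Box p_1\wedge\neg(\Diamond\Box p_0\to p_0))\to p_1$, $\mathbf{bw}^+_2=\bigwedge_{i\leq2}\Diamond p_i\to\bigvee_{i\neq j\leq2}\Diamond(p_i\wedge(p_j\vee\Diamond p_j))$ and $\mathbf{bw}^-_2$, the same with $\mathsf{P}$ for $\Diamond$). $\mathsf{PTAB}(L)$ is the set of pretabular logics (non-tabular, all consistent proper extensions tabular) extending $L$. Let $\mathfrak{G}_\mathbb{Z}=(\mathbb{Z},R_z)$ with $R_z=\{(i,i)\}\cup\{(2i+1,2i)\}\cup\{(2i+1,2i+2)\}$, $\mathsf{Ga}=\mathsf{Log}(\mathfrak{G}_\mathbb{Z})$, $\mathfrak{G}_n=\mathfrak{G}_\mathbb{Z}{\upharpoonright}\{0,\dots,n\}$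 (the $n$-garland) and $\breve{\mathfrak{G}_n}$ its inverse frame. For a frame $\mathfrak{F}$, a point $x$ and $\lambda\leq\omega$, $\mathfrak{F}^x_\lambda$ is obtained by replacing $x$ by a cluster of $1+\lambda$ points having the same successors and predecessors as $x$. *)

(* Defs.v *)
From HB Require Import structures.
From mathcomp Require Import all_boot all_order all_algebra.
From mathcomp Require Import boolp classical_sets cardinality.

Set Implicit Arguments.
Unset Strict Implicit.
Unset Printing Implicit Defensive.

Import GRing.Theory.
Local Open Scope classical_set_scope.

(** Formulas: the primitive modalities are [Box] (future necessity) and
    [PDia] (past possibility). *)

Inductive form : Type :=
| Var of nat
| Bot
| Imp of form & form
| Box of form
| PDia of form.

Definition Neg (a : form) : form := Imp a Bot.
Definition Top : form := Neg Bot.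
Definition Or (a b : form) : form := Imp (Neg a) b.
Definition And (a b : form) : form := Neg (Imp a (Neg b)).
Definition Dia (a : form) : form := Neg (Box (Neg a)).

Fixpoint subst (s : nat -> form) (a : form) : form :=
  match a with
  | Var n => s n
  | Bot => Bot
  | Imp b c => Imp (subst s b) (subst s c)
  | Box b => Box (subst s b)
  | PDia b => PDia (subst s b)
  end.

(** Variables and modal formulas are the atoms of propositional evaluation. *)
Fixpoint beval (v : form -> bool) (a : form) : bool :=
  match a with
  | Bot => false
  | Imp b c => beval v b ==> beval v c
  | _ => v a
  end.

Definition tautology (a : form) : Prop := forall v, beval v a.

(** The adjunction between [PDia] and [Box] makes both modalities normal: the
    K axioms, the converse axioms and both necessitation rules follow. *)
Record tense_logic (L : set form) : Prop := TenseLogic {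
  tl_taut : forall a, tautology a -> L a;
  tl_adj : forall a b, L (Imp (PDia a) b) <-> L (Imp a (Box b));
  tl_mp : forall a b, L a -> L (Imp a b) -> L b;
  tl_subst : forall s a, L a -> L (subst s a) }.

Definition oplus (L G : set form) : set form := smallest tense_logic (L `|` G).

Definition Kt : set form := smallest tense_logic set0.

Definition S4t : set form :=
  let p := Var 0 in
  oplus Kt [set Imp (Box p) p; Imp (Box p) (Box (Box p))].

Definition S5t : set form :=
  let p := Var 0 in oplus S4t [set Imp (Dia p) (Box (Dia p))].

Definition bd2 : form :=
  let p0 := Var 0 in let p1 := Var 1 in
  Imp (Dia (And (Box p1) (Neg (Imp (Dia (Box p0)) p0)))) p1.

(** Width at most [k] for the possibility operator [M]. *)
Definition bw (M : form -> form) (k : nat) : form :=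
  Imp (\big[And/Top]_(i < k.+1) M (Var i))
      (\big[Or/Bot]_(i < k.+1) \big[Or/Bot]_(j < k.+1 | i != j)
         M (And (Var i) (Or (Var j) (M (Var j))))).

Definition S4BP : set form := oplus S4t [set bd2; bw Dia 2; bw PDia 2].

Record frame := Frame {
  world :> Type;
  acc : world -> world -> Prop;
  world_inhabited : inhabited world }.

Fixpoint sat (F : frame) (V : nat -> set F) (x : F) (a : form) : Prop :=
  match a with
  | Var n => V n x
  | Bot => False
  | Imp b c => sat V x b -> sat V x c
  | Box b => forall y : F, acc x y -> sat V y b
  | PDia b => exists2 y : F, acc y x & sat V y b
  end.

Definition Log (F : frame) : set form :=
  [set a | forall (V : nat -> set F) (x : F), sat V x a].

Definition inverse (F : frame) : frame :=
  Frame (fun x y : F => acc y x) (world_inhabited F).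

Definition blowup_proj (F : frame) (x : F) (I : Type) (u : F + I) : F :=
  if u is inl y then y else x.

(** [F^x_lambda], where [lambda] is the cardinality of [I]: the [inr i] are the
    added copies of [x]. The point [x] is assumed to be reflexive, as in every
    preorder, so that [x] and its copies form a cluster. *)
Definition blowup (F : frame) (x : F) (I : Type) : frame :=
  Frame (fun u v : F + I => acc (blowup_proj x u) (blowup_proj x v))
        (inhabits (inl x)).
Arguments blowup F x I : clear implicits.

Definition consistent (L : set form) : Prop := ~ L Bot.

Definition tabular (L : set form) : Prop :=
  exists2 F : frame, finite_set [set: F] & L = Log F.

(** Frames are nonempty, so the inconsistent logic is not tabular; it must be
    excluded explicitly, since it has no consistent extension at all. *)
Definition pretabular (L : set form) : Prop :=
  [/\ consistent L, ~ tabular L &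
      forall L', tense_logic L' -> L `<` L' -> consistent L' -> tabular L'].

Definition PTAB (L : set form) : set (set form) :=
  [set M | [/\ tense_logic M, L `<=` M & pretabular M]].

Definition Rz (i j : int) : Prop :=
  [\/ i = j,
      exists k : int, i = (2 * k + 1)%R /\ j = (2 * k)%R |
      exists k : int, i = (2 * k + 1)%R /\ j = (2 * k + 2)%R].

Definition garlandZ : frame := Frame Rz (inhabits 0%R).

Definition Ga : set form := Log garlandZ.

(** The restriction of [garlandZ] to [0, ..., n], carried by ['I_n.+1]. *)
Definition garland (n : nat) : frame :=
  Frame (fun i j : 'I_n.+1 => Rz (Posz i) (Posz j)) (inhabits ord0).

(* Main.v *)
(** Each logic [L] of the list is non-tabular, and the logics of the list are
    pairwise incomparable, so the theorem reduces to one claim: a consistent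
    non-tabular tense logic [M] above [S4BP] is contained in a logic of the list.

    The axioms of [S4BP] are canonical, hence in the canonical frame of [M] the
    clusters have at most two neighbours each, with minimal and maximal ones
    alternating: every component is a garland or a crown of clusters. Finitely
    many clusters, and finitely many points, are separated by formulas, so a
    formula refuted on a suitable image of part of the canonical frame can be
    refuted there by a definable valuation. If there are arbitrarily long simple
    paths of clusters, this gives [M <= Ga]. Otherwise, if the sizes of the
    clusters are bounded, then so are the sizes of the components and [M] is
    tabular. Otherwise clusters of unbounded size occur at a fixed position in a
    fixed garland or crown; collapsing all other clusters to points, and folding
    a crown, or a garland about its middle, so that the big cluster comes to lie
    at an end, gives [M <= Log (G_n)^m_omega] or its dual, with [2m < n] or
    [n = 0]; for [n = 0] this logic is [S5t]. *)

Require Import Defs.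
From mathcomp Require Import all_boot all_order all_algebra.
From mathcomp Require Import boolp classical_sets cardinality.
From mathcomp Require Import zify.
(* [all_algebra] shadows [form]. *)
Import Defs.

Set Implicit Arguments.
Unset Strict Implicit.
Unset Printing Implicit Defensive.

Local Open Scope classical_set_scope.

(** * Truth, bisimulations and the canonical frame *)

(** [M] is not known to be determined by its frames, so a refutation can be carried to the canonical
    frame only as a valuation by definable sets. The obstacle is that neither a component nor one of
    its clusters need be definable. What is used instead is a function on the whole canonical frame
    that takes finitely many values, has definable level sets, and gives the intended position on
    one component only. Truth at a point depends on its component alone, so the values elsewhere do
    no harm. Two finiteness arguments make such functions sufficient: a formula does not see beyond
    its modal depth, so a finite stretch of a long path does for the infinite garland; and it
    distinguishes finitely many types of points, so finitely many points do for an infinite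
    cluster. *)

Fixpoint depth (a : form) : nat :=
  match a with
  | Imp b c => maxn (depth b) (depth c)
  | Box b | PDia b => (depth b).+1
  | _ => 0
  end.

Fixpoint var_bound (a : form) : nat :=
  match a with
  | Var n => n.+1
  | Bot => 0
  | Imp b c => maxn (var_bound b) (var_bound c)
  | Box b | PDia b => var_bound b
  end.

(** [Z d] has to be matched for [d] more steps only, so that truth can be
    transferred from a finite piece of a frame. *)
Lemma bisim_sat (F G : frame) (U : nat -> set F) (V : nat -> set G) (k : nat)
    (Z : nat -> F -> G -> Prop) :
  (forall d x v, Z d x v -> forall p, p < k -> U p x <-> V p v) ->
  (forall d x v, Z d.+1 x v ->
     (forall y, acc x y -> exists2 w, acc v w & Z d y w) /\
     (forall w, acc v w -> exists2 y, acc x y & Z d y w)) ->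
  (forall d x v, Z d.+1 x v ->
     (forall y, acc y x -> exists2 w, acc w v & Z d y w) /\
     (forall w, acc w v -> exists2 y, acc y x & Z d y w)) ->
  forall a d x v, var_bound a <= k -> depth a <= d -> Z d x v ->
  sat U x a <-> sat V v a.
Proof.
move=> Zv ZR ZL; elim=> [n||b IHb c IHc|b IH|b IH] d x v /=.
- by move=> nk _ /Zv; apply.
- by [].
- rewrite !geq_max => /andP[kb kc] /andP[db dc] xv.
  have := IHb _ _ _ kb db xv; have := IHc _ _ _ kc dc xv; tauto.
- case: d => // d kb db /ZR[forth back]; split=> H.
    by move=> w /back[y xy /(IH _ _ _ kb db) <-]; apply: H.
  by move=> y /forth[w vw /(IH _ _ _ kb db) ->]; apply: H.
- case: d => // d kb db /ZL[forth back]; split=> -[].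
    by move=> y /forth[w vw /(IH _ _ _ kb db) yw] /yw; exists w.
  by move=> w /back[y vw /(IH _ _ _ kb db) yw] /yw; exists y.
Qed.

Section Semantics.
Variables (F : frame) (V : nat -> set F).
Implicit Types (x y : F) (a b : form).

Lemma sat_neg x a : sat V x (Neg a) <-> ~ sat V x a.
Proof. by []. Qed.

Lemma sat_and x a b : sat V x (And a b) <-> sat V x a /\ sat V x b.
Proof.
rewrite /=; split=> [H|[? ?] H]; last exact: H.
by split; apply: contrapT => H'; apply: H => // ?.
Qed.

Lemma sat_or x a b : sat V x (Or a b) <-> sat V x a \/ sat V x b.
Proof.
rewrite /=; split=> [H|[] // ? ?//].
by case: (pselect (sat V x a)) => ?; [left|right; apply: H].
Qed.

Lemma sat_dia x a : sat V x (Dia a) <-> exists2 y, acc x y & sat V y a.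
Proof.
rewrite /=; split=> [H|[y xy ya] H]; last exact: H ya.
by apply: contrapT => H'; apply: H => y xy ya; apply: H'; exists y.
Qed.

Lemma sat_big_and (I : Type) (r : seq I) (A : I -> form) (P : pred I) x :
  sat V x (\big[And/Top]_(i <- r | P i) A i) <->
  List.Forall (fun i => P i -> sat V x (A i)) r.
Proof.
elim: r => [|i r IH].
  by rewrite big_nil; split=> [_|_ []]; apply: List.Forall_nil.
rewrite big_cons List.Forall_cons_iff -IH; case: (P i).
  by rewrite sat_and; split=> -[H ?]; split=> //; apply: H.
by split=> [?|[]].
Qed.

Lemma sat_big_or (I : Type) (r : seq I) (A : I -> form) (P : pred I) x :
  sat V x (\big[Or/Bot]_(i <- r | P i) A i) <->
  List.Exists (fun i => P i /\ sat V x (A i)) r.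
Proof.
elim: r => [|i r IH]; first by rewrite big_nil List.Exists_nil.
rewrite big_cons List.Exists_cons -IH; case: (P i).
  by rewrite sat_or; split=> [[]|[[]|]]; auto.
by split=> [|[[]|]]; auto.
Qed.

Lemma Forall_index_enum (I : finType) (P : I -> Prop) :
  List.Forall P (index_enum I) <-> forall i, P i.
Proof.
have {1}-> : index_enum I = enum I by rewrite enumT.
split=> [H i|H]; last by elim: (enum I) => [|i s IH]; constructor.
have: i \in enum I by rewrite mem_enum.
elim: (enum I) H => // j s IH /List.Forall_cons_iff[Pj Ps].
by rewrite in_cons => /orP[/eqP->//|]; apply: IH.
Qed.

Lemma Exists_index_enum (I : finType) (P : I -> Prop) :
  List.Exists P (index_enum I) <-> exists i, P i.
Proof.
rewrite List.Exists_exists; split=> [[i []]|[i Pi]]; first by exists i.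
exists i; split=> //.
have: i \in index_enum I by rewrite mem_index_enum.
elim: (index_enum I) => // j s IH.
by rewrite in_cons => /orP[/eqP->|/IH]; [left|right].
Qed.

Lemma sat_subst s x a :
  sat V x (subst s a) <-> sat (fun p => [set y | sat V y (s p)]) x a.
Proof.
elim: a x => //= [b IHb c IHc|b IH|b IH] x.
- by rewrite IHb IHc.
- by split=> H y /H /IH.
- by split=> -[y xy /IH]; exists y.
Qed.

End Semantics.

Lemma Log_tense (F : frame) : tense_logic (Log F).
Proof.
split.
- move=> a ta V x; have := ta (fun b => `[<sat V x b>]).
  suff -> : beval (fun b => `[<sat V x b>]) a = `[<sat V x a>] by move/asboolP.
  elim: {ta}a => //=; first by apply/esym/asboolP.
  move=> b -> c ->; apply/implyP/asboolP => [H /asboolP/H/asboolP//|H].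
  by move/asboolP/H/asboolP.
- move=> a b; split=> /= H V x.
    by move=> xa y xy; apply: H; exists x.
  by case=> y yx ya; apply: H ya _ yx.
- by move=> a b Ha Hab V x; apply: Hab; apply: Ha.
- by move=> s a Ha V x; apply/sat_subst; apply: Ha.
Qed.

Lemma Log_consistent (F : frame) : consistent (Log F).
Proof. by case: (world_inhabited F) => x /(_ (fun _ => setT) x). Qed.

(** The properties of the canonical frame of [M] that are used; [A] is the
    family of the sets of points defined by formulas. *)
Record general_frame (M : set form) (W : frame) (A : set (set W)) : Prop := {
  admC : forall D, A D -> A (~` D);
  admI : forall D E, A D -> A E -> A (D `&` E);
  admT : A setT;
  adm_box : forall D, A D -> A [set x | forall y, acc x y -> D y];
  adm_sound : forall a, M a ->
    forall V, (forall p, A (V p)) -> forall x, sat V x a;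
  adm_complete : forall a, ~ M a ->
    exists V x, (forall p, A (V p)) /\ ~ sat V x a;
  adm_diff : forall x y : W, x <> y -> exists D, [/\ A D, D x & ~ D y];
  adm_tight : forall x y : W, ~ acc x y ->
    exists D, [/\ A D, forall z, acc x z -> D z & ~ D y] }.

(** * The canonical general frame *)

Section Canonical.
Variable M : set form.
Hypothesis ML : tense_logic M.
Hypothesis Mcons : consistent M.

Ltac taut := let v := fresh "v" in move=> v /=;
  repeat match goal with |- context [beval v ?b] => case: (beval v b) end;
  repeat match goal with |- context [v ?b] => case: (v b) end; by [].

Lemma tl_taut1 a b : tautology (Imp a b) -> M a -> M b.
Proof. by move=> /(tl_taut ML) ? /(tl_mp ML); apply. Qed.

Lemma tl_taut2 a b c : tautology (Imp a (Imp b c)) -> M a -> M b -> M c.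
Proof. by move=> /tl_taut1 H /H /[swap] /(tl_mp ML); apply. Qed.

Lemma tl_trans a b c : M (Imp a b) -> M (Imp b c) -> M (Imp a c).
Proof. by apply: tl_taut2; taut. Qed.

(** The counit of the adjunction; with the unit [BoxP_unit] it yields monotonicity, and from that
    the K principle for [Box] and additivity of [PDia]. *)
Lemma PBox_cancel a : M (Imp (PDia (Box a)) a).
Proof. apply/(tl_adj ML); apply: (tl_taut ML); taut. Qed.

Lemma BoxP_unit a : M (Imp a (Box (PDia a))).
Proof. apply/(tl_adj ML); apply: (tl_taut ML); taut. Qed.

Lemma Box_mono a b : M (Imp a b) -> M (Imp (Box a) (Box b)).
Proof. by move=> ab; apply/(tl_adj ML)/(tl_trans (PBox_cancel a) ab). Qed.

Lemma P_mono a b : M (Imp a b) -> M (Imp (PDia a) (PDia b)).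
Proof. by move=> ab; apply/(tl_adj ML)/(tl_trans ab (BoxP_unit b)). Qed.

Lemma Box_nec a : M a -> M (Box a).
Proof.
move=> Ma; apply: (@tl_mp _ ML Top); first by apply: (tl_taut ML); taut.
by apply/(tl_adj ML); apply: tl_taut1 Ma; taut.
Qed.

Lemma H_nec a : M a -> M (Neg (PDia (Neg a))).
Proof.
move=> Ma; apply/(tl_adj ML).
by apply: tl_taut1 Ma; taut.
Qed.

Lemma Box_and a b c :
  M (Imp a (Imp b c)) -> M (Imp (Box a) (Imp (Box b) (Box c))).
Proof.
move=> abc; suff H : M (Imp (And (Box a) (Box b)) (Box c)).
  by apply: tl_taut1 H; taut.
have H1 : M (Imp (PDia (And (Box a) (Box b))) a).
  by apply: (tl_trans _ (PBox_cancel a)); apply/P_mono/(tl_taut ML); taut.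
have H2 : M (Imp (PDia (And (Box a) (Box b))) b).
  by apply: (tl_trans _ (PBox_cancel b)); apply/P_mono/(tl_taut ML); taut.
apply/(tl_adj ML).
have H3 : M (Imp (PDia (And (Box a) (Box b))) (Imp b c)).
  by apply: (tl_taut2 _ abc H1); taut.
by apply: (tl_taut2 _ H3 H2); taut.
Qed.

Lemma P_or a b c :
  M (Imp a (Or b c)) -> M (Imp (PDia a) (Or (PDia b) (PDia c))).
Proof.
move=> abc; apply/(tl_adj ML).
apply: (tl_trans abc).
have Hb : M (Imp b (Box (Or (PDia b) (PDia c)))).
  by apply: (tl_trans (BoxP_unit b)); apply/Box_mono/(tl_taut ML); taut.
have Hc : M (Imp c (Box (Or (PDia b) (PDia c)))).
  by apply: (tl_trans (BoxP_unit c)); apply/Box_mono/(tl_taut ML); taut.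
by apply: (tl_taut2 _ Hb Hc); taut.
Qed.

Definition theory (T : set form) : Prop :=
  [/\ M `<=` T, forall a b, T (Imp a b) -> T a -> T b & ~ T Bot].

Definition mcs (T : set form) : Prop := theory T /\ forall a, T a \/ T (Neg a).

Lemma lindenbaum (T0 : set form) : theory T0 -> exists2 T, mcs T & T0 `<=` T.
Proof.
move=> T0th; pose X := {T | theory T}.
pose R (S T : X) := `[<sval S `<=` sval T>].
have Rr S : R S S by apply/asboolP.
have Rt : forall r s t : X, R r s -> R s t -> R r t.
  by move=> r s t /asboolP rs /asboolP st; apply/asboolP => a /rs /st.
pose Y := {T : X | R (exist _ T0 T0th) T}.
pose RY (S T : Y) := R (sval S) (sval T).
have RYanti (S T : Y) : RY S T -> RY T S -> S = T.
  case: S T => [[S ?] ?] [[T ?] ?] /asboolP/= ST /asboolP/= TS.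
  by apply: eq_exist; apply: eq_exist; apply/seteqP.
have chain (C : set Y) : total_on C RY -> exists T, forall S, C S -> RY S T.
  move=> totC.
  have [[S0 CS0]|Cn] := pselect (exists S, C S); last first.
    by exists (exist _ (exist _ T0 T0th) (Rr _)) => S CS; case: Cn; exists S.
  pose U : set form := [set a | exists2 S, C S & sval (sval S) a].
  have Uth : theory U.
    split.
    - by move=> a Ma; exists S0 => //; case: (svalP (sval S0)) => + _ _; apply.
    - move=> a b [S CS Sab] [S' CS' Sa].
      have [/asboolP SS|/asboolP SS] := totC _ _ CS CS'.
        exists S' => //; case: (svalP (sval S')) => _ + _; apply; last exact: Sa.
        exact: SS.
      exists S => //; case: (svalP (sval S)) => _ + _; apply; first exact: Sab.
      exact: SS.
    - by case=> S _; case: (svalP (sval S)).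
  have TU : R (exist _ T0 T0th) (exist _ U Uth).
    apply/asboolP => a /= Ta; exists S0 => //.
    by case: S0 {CS0} => S /= /asboolP; apply.
  by exists (exist _ (exist _ U Uth) TU) => S CS; apply/asboolP => a Sa; exists S.
have [T Tmax] := Zorn (fun S : Y => Rr _)
  (fun r s t : Y => Rt (sval r) (sval s) (sval t)) RYanti chain.
case: T Tmax => [[T Tth] TT] Tmax; have T0T : T0 `<=` T by move/asboolP: (TT).
exists T => //.
split=> // a; have [MT Tmp Tbot] := (Tth).
have [Ta|Ta] := pselect (T a); [by left|right].
(* [U] is the theory generated by [T] and [a]. It is consistent if [T] lacks [Neg a], and then
   maximality puts [a] into [T]. *)
pose U : set form := [set b | T (Imp a b)].
have TU : T `<=` U.
  by move=> b Tb; apply: Tmp Tb; apply/MT/(tl_taut ML); taut.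
have Ua : U a by apply/MT/(tl_taut ML); taut.
apply: contrapT => Tna.
have Uth : theory U.
  split=> //; first by move=> b /MT /TU.
  move=> b c Ub Uc; apply: (Tmp _ _ _ Uc); apply: (Tmp _ _ _ Ub).
  by apply/MT/(tl_taut ML); taut.
have T0U : R (exist _ T0 T0th) (exist _ U Uth).
  by apply/asboolP => b /T0T/TU.
have /Tmax [UT] : RY (exist _ (exist _ T Tth) TT) (exist _ (exist _ U Uth) T0U).
  exact/asboolP.
by apply: Ta; rewrite -UT.
Qed.

Section Mcs.
Variable w : set form.
Hypothesis wm : mcs w.

Lemma mcs_mp a b : w (Imp a b) -> w a -> w b.
Proof. by case: wm => -[_ + _] _; apply. Qed.

Lemma mcs_sub : M `<=` w. Proof. by case: wm => -[]. Qed.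

Lemma mcs_bot : ~ w Bot. Proof. by case: wm => -[]. Qed.

Lemma mcs_imp a b : w (Imp a b) <-> (w a -> w b).
Proof.
split=> [|H]; first exact: mcs_mp.
case: (wm.2 a) => wa.
  by apply: mcs_mp (H wa); apply/mcs_sub/(tl_taut ML); taut.
by apply: mcs_mp wa; apply/mcs_sub/(tl_taut ML); taut.
Qed.

Lemma mcs_neg a : w (Neg a) <-> ~ w a.
Proof. by rewrite mcs_imp; split=> H /H // /mcs_bot. Qed.

Lemma mcs_M a b : M (Imp a b) -> w a -> w b.
Proof. by move/mcs_sub/mcs_mp. Qed.

End Mcs.

Lemma lindenbaum_not a : ~ M a -> exists2 w, mcs w & ~ w a.
Proof.
move=> Ma; have [] := @lindenbaum [set b | M (Imp (Neg a) b)].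
  split=> /=.
  - by move=> b; apply: tl_taut1; taut.
  - by move=> b c; apply: tl_taut2; taut.
  - by move=> H; apply: Ma; apply: tl_taut1 H; taut.
move=> w wm sub; exists w => //; apply/mcs_neg => //; apply: sub.
by apply: (tl_taut ML); taut.
Qed.

Definition canonical_acc (w v : {w | mcs w}) : Prop :=
  forall a, sval w (Box a) -> sval v a.

Lemma canonical_inhabited : inhabited {w | mcs w}.
Proof. by have [w wm _] := lindenbaum_not Mcons; exists; exists w. Qed.

Definition canonical : frame := Frame canonical_acc canonical_inhabited.

Lemma canonical_box (w : canonical) a :
  sval w (Box a) <-> forall v : canonical, acc w v -> sval v a.
Proof.
split=> [wa v|H]; first exact.
apply: contrapT => wa; have wm := svalP w.
have [] := @lindenbaum [set b | sval w (Box (Imp (Neg a) b))].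
  split=> /=.
  - move=> b Mb; apply: (mcs_sub wm); apply: Box_nec.
    by apply: tl_taut1 Mb; taut.
  - move=> b c wbc wb; apply: (mcs_mp wm _ wb); apply: (mcs_mp wm _ wbc).
    by apply/(mcs_sub wm)/Box_and/(tl_taut ML); taut.
  - move=> wb; apply: wa; apply: (mcs_M wm _ wb).
    by apply/Box_mono/(tl_taut ML); taut.
move=> v vm sub.
have /(H (exist _ v vm)) /= : @acc canonical w (exist _ v vm).
  move=> b wb; apply: sub => /=; apply: (mcs_M wm _ wb).
  by apply/Box_mono/(tl_taut ML); taut.
by apply/(mcs_neg vm)/sub => /=; apply/(mcs_sub wm)/Box_nec/(tl_taut ML); taut.
Qed.

Lemma canonical_pdia (w : canonical) a :
  sval w (PDia a) <-> exists2 v : canonical, acc v w & sval v a.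
Proof.
have wm := svalP w; split=> [wa|[v vw va]]; last first.
  by apply: vw; apply: (mcs_M (svalP v) (BoxP_unit a)).
(* As [w] is maximal, these are the [b] for which [w] says that [a] has always implied [b]: the
   least that a predecessor containing [a] must contain. *)
have [] := @lindenbaum [set b | ~ sval w (PDia (And a (Neg b)))].
  split=> /=.
  - move=> b Mb; apply/(mcs_neg wm)/(mcs_sub wm).
    have Mn : M (Neg (And a (Neg b))) by apply: tl_taut1 Mb; taut.
    by apply: (tl_trans _ (PBox_cancel Bot)); apply: P_mono; apply: tl_taut1 Mn; taut.
  - move=> b c wbc wb wc.
    have: sval w (Or (PDia (And a (Neg (Imp b c)))) (PDia (And a (Neg b)))).
      by apply: (mcs_M wm _ wc); apply/P_or/(tl_taut ML); taut.
    move/(mcs_imp wm) => H; apply: wb; apply: H.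
    by apply/(mcs_neg wm).
  - apply; apply: (mcs_M wm _ wa).
    by apply/P_mono/(tl_taut ML); taut.
move=> v vm sub; exists (exist _ v vm).
  move=> b /= vb; apply: contrapT => wb.
  suff: v (Neg (Box b)) by move/(mcs_neg vm).
  apply: sub => /= wH; apply: wb.
  apply: (mcs_M wm _ wH); apply: (tl_trans _ (PBox_cancel b)).
  by apply/P_mono/(tl_taut ML); taut.
apply: sub => /= wH; apply: (mcs_bot wm); apply: (mcs_M wm _ wH).
by apply: (tl_trans _ (PBox_cancel Bot)); apply/P_mono/(tl_taut ML); taut.
Qed.

(** With an arbitrary substitution in place of the identity, the truth lemma covers every valuation
    by definable sets, as [adm_sound] requires. *)
Lemma canonical_truth (s : nat -> form) (w : canonical) a :
  sat (fun p => [set v : canonical | sval v (s p)]) w a <-> sval w (subst s a).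
Proof.
elim: a w => [n||b IHb c IHc|b IH|b IH] w //=.
- by split=> // /(mcs_bot (svalP w)).
- by rewrite (mcs_imp (svalP w)) IHb IHc.
- by rewrite canonical_box; split=> H v /H /IH.
- by rewrite canonical_pdia; split=> -[v vw /IH]; exists v.
Qed.

Lemma subst_Var a : subst Var a = a.
Proof. by elim: a => //= [b -> c ->|b ->|b ->]. Qed.

Theorem canonical_general_frame :
  general_frame M [set D : set canonical | exists a, D = [set w | sval w a]].
Proof.
split.
- move=> _ [a ->]; exists (Neg a); apply/seteqP.
  by split=> w /=; rewrite (mcs_neg (svalP w)).
- move=> _ _ [a ->] [b ->]; exists (And a b); apply/seteqP.
  split=> w /=; rewrite (mcs_neg (svalP w)) (mcs_imp (svalP w)) (mcs_neg (svalP w)).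
    by case=> ? ? H; apply: H.
  by move=> H; split; apply: contrapT => H'; apply: H => // /H'.
- exists Top; apply/seteqP; split=> w //= _.
  by apply/(mcs_sub (svalP w))/(tl_taut ML); taut.
- move=> _ [a ->]; exists (Box a); apply/seteqP.
  by split=> w /= /canonical_box.
- move=> a Ma V /choice[s Vs] w.
  rewrite (_ : V = fun p => [set v : canonical | sval v (s p)]); last exact/funext.
  by apply/canonical_truth/(mcs_sub (svalP w))/(tl_subst ML).
- move=> a /lindenbaum_not[w wm wa].
  exists (fun p => [set v : canonical | sval v (Var p)]), (exist _ w wm).
  by split=> [p|/canonical_truth]; [exists (Var p)|rewrite subst_Var].
- move=> x y xy; apply: contrapT => H; apply: xy.
  have H' a : sval x a -> sval y a.
    by move=> xa; apply: contrapT => ya; apply: H; eexists; split; [exists a| |].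
  have {H} : sval x = sval y.
    apply/seteqP; split=> // a ya; apply: contrapT => /(mcs_neg (svalP x))/H'.
    by move/(mcs_neg (svalP y)).
  by case: x y {H'} => [x xm] [y ym] /= E; apply: eq_exist.
- move=> x y /existsNP[a /not_implyP[xa ya]].
  exists [set w | sval w a]; split=> //; first by exists a.
  by move=> z; apply.
Qed.

End Canonical.

Lemma exists_general_frame (M : set form) : tense_logic M -> consistent M ->
  exists (W : frame) (A : set (set W)), general_frame M A.
Proof. by move=> ML Mc; eexists; eexists; apply: (canonical_general_frame ML Mc). Qed.

(** * Frames of S4BP *)

(** The first-order counterparts of the axioms of [S4BP]. *)
Record s4bp_frame (F : frame) : Prop := {
  fr_refl : forall x : F, acc x x;
  fr_trans : forall x y z : F, acc x y -> acc y z -> acc x z;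
  fr_depth : forall x y z : F, acc x y -> acc y z -> acc y x \/ acc z y;
  fr_forth : forall (x : F) (y : 'I_3 -> F), (forall i, acc x (y i)) ->
    exists i j, i != j /\ acc (y i) (y j);
  fr_back : forall (x : F) (y : 'I_3 -> F), (forall i, acc (y i) x) ->
    exists i j, i != j /\ acc (y i) (y j) }.

Lemma sat_bw (F : frame) (V : nat -> set F) (x : F) (m : form -> form)
    (S : F -> F -> Prop) (k : nat) :
  (forall y a, sat V y (m a) <-> exists2 z, S y z & sat V z a) ->
  sat V x (bw m k) <->
  ((forall i : 'I_k.+1, exists2 y, S x y & V i y) ->
   exists i j : 'I_k.+1, i != j /\
     exists2 y, S x y & V i y /\ (V j y \/ exists2 z, S y z & V j z)).
Proof.
move=> mS; rewrite /bw /=.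
rewrite (@sat_big_and _ V _ _ (fun i : 'I_k.+1 => m (Var i)) xpredT).
rewrite Forall_index_enum.
rewrite (@sat_big_or _ V _ _ (fun i : 'I_k.+1 => \big[Or/Bot]_(j < k.+1 | i != j)
         m (And (Var i) (Or (Var j) (m (Var j))))) xpredT).
rewrite Exists_index_enum.
have E1 : (forall i : 'I_k.+1, true -> sat V x (m (Var i))) <->
    (forall i : 'I_k.+1, exists2 y, S x y & V i y).
  by split=> H i; [have /mS := H i isT | move=> _; apply/mS; apply: H].
rewrite E1; split=> H /H.
  case=> i [_ /sat_big_or/Exists_index_enum[j [ij /mS[y xy]]]].
  move=> /sat_and[yi /sat_or yj]; exists i, j; split=> //; exists y => //.
  by split=> //; case: yj => [|/mS]; [left|right].
case=> i [j [ij [y xy [yi yj]]]]; exists i; split=> //.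
apply/sat_big_or/Exists_index_enum; exists j; split=> //; apply/mS; exists y => //.
by apply/sat_and; split=> //; apply/sat_or; case: yj; [left|right; apply/mS].
Qed.

Lemma smallest_le (L G X : set form) :
  tense_logic L -> X `<=` L -> G `<=` L -> oplus X G `<=` L.
Proof.
by move=> LL XL GL; apply: smallest_sub => // a [/XL|/GL].
Qed.

Lemma oplus_left (X G : set form) : X `<=` oplus X G.
Proof. by apply: sub_smallest; left. Qed.

Lemma oplus_right (X G : set form) : G `<=` oplus X G.
Proof. by apply: sub_smallest; right. Qed.

Lemma S4t_axioms : S4t (Imp (Box (Var 0)) (Var 0)) /\
  S4t (Imp (Box (Var 0)) (Box (Box (Var 0)))).
Proof.
by split; rewrite /S4t /=; apply: (@oplus_right Kt); [left|right].
Qed.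

Lemma S4BP_axioms : [/\ S4t `<=` S4BP, S4BP bd2, S4BP (bw Dia 2)
  & S4BP (bw PDia 2)].
Proof.
split; first exact: oplus_left.
- by apply: (@oplus_right S4t); left; left.
- by apply: (@oplus_right S4t); left; right.
- by apply: (@oplus_right S4t); right.
Qed.

Lemma S4t_sound (F : frame) : (forall x : F, acc x x) ->
  (forall x y z : F, acc x y -> acc y z -> acc x z) -> S4t `<=` Log F.
Proof.
move=> R T; apply: smallest_le; first exact: Log_tense.
  by apply: smallest_sub => //; exact: Log_tense.
move=> _ [->|->] V x /= H; first exact: H.
by move=> y xy z yz; apply: H; apply: T yz.
Qed.

Lemma sat_bd2 (F : frame) (V : nat -> set F) (x : F) :
  sat V x bd2 <->
  (forall y z, acc x y -> (forall y', acc y y' -> V 1 y') -> acc y z ->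
     (forall z', acc z z' -> V 0 z') -> ~ V 0 y -> V 1 x).
Proof.
rewrite (_ : sat V x bd2 = (sat V x (Dia (And (Box (Var 1))
  (Neg (Imp (Dia (Box (Var 0))) (Var 0))))) -> V 1 x)) // sat_dia; split.
  move=> H y z xy y1 yz z0 y0; apply: H; exists y => //.
  apply/sat_and; split=> // H; apply: y0.
  apply: (H : sat V y (Dia (Box (Var 0))) -> V 0 y).
  by apply/sat_dia; exists z.
move=> H [y xy /sat_and[y1 y0]].
have [/sat_dia[z yz z0] ny] : sat V y (Dia (Box (Var 0))) /\ ~ V 0 y.
  by split; [apply: contrapT => N; apply: y0 => /N | move=> N; apply: y0].
exact: (H y z).
Qed.

Lemma sat_pdia (F : frame) (V : nat -> set F) (x : F) a :
  sat V x (PDia a) <-> exists2 y, acc y x & sat V y a.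
Proof. by []. Qed.

Lemma S4BP_sound (F : frame) : s4bp_frame F -> S4BP `<=` Log F.
Proof.
case=> R T D W1 W2; apply: smallest_le; first exact: Log_tense.
  exact: S4t_sound.
move=> _ [[->|->]|->] V x.
- apply/sat_bd2 => y z xy y1 yz z0 y0.
  by have [/y1//|/z0] := D _ _ _ xy yz.
- apply/(sat_bw _ _ (sat_dia V)) => H.
  have /choice[y xy] : forall i : 'I_3, exists y, acc x y /\ V i y.
    by move=> i; have [y] := H i; exists y.
  have [i|i [j [ij yij]]] := W1 x y; first by case: (xy i).
  exists i, j; split=> //; exists (y i); first by case: (xy i).
  by split; [case: (xy i)|right; exists (y j) => //; case: (xy j)].
- apply/(sat_bw _ _ (sat_pdia V)) => H.
  have /choice[y xy] : forall i : 'I_3, exists y, acc y x /\ V i y.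
    by move=> i; have [y] := H i; exists y.
  have [i|i [j [ij yij]]] := W2 x y; first by case: (xy i).
  exists j, i; split; first by rewrite eq_sym.
  exists (y j); first by case: (xy j).
  by split; [case: (xy j)|right; exists (y i) => //; case: (xy i)].
Qed.

(** * Definable sets and canonicity of the axioms *)

Section Admissible.
Variables (M : set form) (W : frame) (A : set (set W)).
Hypothesis gf : general_frame M A.

Lemma admD D E : A D -> A E -> A (D `\` E).
Proof. by move=> AD AE; rewrite setDE; apply: (admI gf) => //; apply: (admC gf). Qed.

Lemma admU D E : A D -> A E -> A (D `|` E).
Proof.
move=> AD AE; rewrite -[_ `|` _]setCK setCU.
by apply: (admC gf); apply: (admI gf); apply: (admC gf).
Qed.

Lemma adm0 : A set0.
Proof. by rewrite -setCT; apply: (admC gf); apply: (admT gf). Qed.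

Lemma adm_all (I : eqType) (s : seq I) (D : I -> set W) :
  (forall i, i \in s -> A (D i)) -> A [set x | forall i, i \in s -> D i x].
Proof.
elim: s => [|i s IH] AD.
  by rewrite (_ : [set _ | _] = setT); [apply: (admT gf)|apply/seteqP; split].
rewrite (_ : [set _ | _] = D i `&` [set x | forall i, i \in s -> D i x]).
  apply: (admI gf); first by apply: AD; rewrite mem_head.
  by apply: IH => j js; apply: AD; rewrite in_cons js orbT.
apply/seteqP; split=> [x H|x [xi H] j] /=.
  by split=> [|j js]; apply: H; rewrite in_cons ?eqxx ?js ?orbT.
by rewrite in_cons => /orP[/eqP->|/H].
Qed.

(** Since [h] has finitely many values, any [Q] whatever has a preimage that is a finite Boolean
    combination of level sets. This is how arbitrary valuations on garlands are pulled back to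
    definable ones. *)
Lemma adm_preimage (h : W -> nat) (k : nat) (Q : nat -> Prop) :
  (forall x, h x <= k) -> (forall i, A [set x | h x = i]) ->
  A [set x | Q (h x)].
Proof.
move=> hk Ah.
rewrite (_ : [set _ | _] = [set x | forall i, i \in iota 0 k.+1 ->
   ([set x | h x <> i] `|` [set x | Q i]) x]); last first.
  apply/seteqP; split=> [x Qx i _ /=|x H].
    by have [<-|] := pselect (h x = i); [right|left].
  have [||] // := H (h x).
  by rewrite mem_iota; have := hk x; lia.
apply: adm_all => i _; apply: admU; first exact/(admC gf)/Ah.
have [Qi|Qi] := pselect (Q i).
  by rewrite (_ : [set _ | _] = setT); [apply: (admT gf)|apply/seteqP; split].
by rewrite (_ : [set _ | _] = set0); [apply: adm0|apply/seteqP; split].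
Qed.

(** The sets [S i] themselves need not belong to [A]. In the induction the new value [k.+1] is given
    to the intersection of the sets that separate [S k.+1] from each earlier one, and the old
    function is kept outside. *)
Lemma separating_function (k : nat) (S : nat -> set W) :
  (forall i j, i <= k -> j <= k -> i <> j ->
     exists D, [/\ A D, S i `<=` D & S j `<=` ~` D]) ->
  exists e : W -> nat, [/\ forall i x, i <= k -> S i x -> e x = i,
    forall x, e x <= k & forall i, A [set x | e x = i]].
Proof.
elim: k => [|k IH] sep.
  exists (fun _ => 0); split=> // [[]//|[|i]].
    by rewrite (_ : [set _ | _] = setT); [apply: (admT gf)|apply/seteqP; split].
  by rewrite (_ : [set _ | _] = set0); [apply: adm0|apply/seteqP; split].
have [|e [eS ek eA]] := IH.
  by move=> i j ik jk; apply: sep; lia.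
have /choice[D DP] : forall j, exists D, j <= k ->
    [/\ A D, S k.+1 `<=` D & S j `<=` ~` D].
  move=> j; have [jk|jk] := leqP j k; last by exists setT.
  have [|||D HD] := sep k.+1 j; try lia.
  by exists D.
pose E := [set x | forall j, j \in iota 0 k.+1 -> D j x].
have AE : A E by apply: adm_all => j; rewrite mem_iota => jk; have [|//] := DP j; lia.
exists (fun x => if pselect (E x) then k.+1 else e x); split.
- move=> i x ik Sx; case: pselect => Ex /=.
    apply: contrapT => ik'; have ik'' : i <= k by lia.
    case: (DP i ik'') => _ _ /(_ _ Sx); apply; apply: Ex.
    by rewrite mem_iota; lia.
  apply: eS => //; rewrite leqNgt; apply/negP => ki; apply: Ex => j.
  rewrite mem_iota => jk; have [|_ + _] := DP j; first lia.
  by apply; have <- : i = k.+1 by lia.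
- by move=> x; case: pselect => //= _; apply: leq_trans (ek x) _.
- move=> i; have [->|ik] := eqVneq i k.+1.
    rewrite (_ : [set _ | _] = E) //; apply/seteqP; split=> x /=.
      by case: pselect => //= _ exk; have := ek x; lia.
    by case: pselect.
  rewrite (_ : [set _ | _] = [set x | e x = i] `\` E); first exact: admD.
  apply/seteqP; split=> x /=; case: pselect => //=.
  - by lia.
  - by move=> Ex [].
  - by move=> _ [].
Qed.

Lemma separated_points (x y : W) : x <> y ->
  exists D, [/\ A D, [set x] `<=` D & [set y] `<=` ~` D].
Proof.
by move=> /(adm_diff gf)[D [AD Dx Dy]]; exists D; split=> // _ ->.
Qed.

Hypothesis ML : S4BP `<=` M.

Lemma general_frame_refl (x : W) : acc x x.
Proof.
apply: contrapT => /(adm_tight gf)[D [AD Dx xD]].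
apply: xD; have : M (Imp (Box (Var 0)) (Var 0)).
  by case: S4t_axioms S4BP_axioms => [T4 _] [/(_ _ T4)/ML].
by move=> /(adm_sound gf)/(_ (fun _ => D) (fun _ => AD) x) /=; apply.
Qed.

Lemma general_frame_trans (x y z : W) : acc x y -> acc y z -> acc x z.
Proof.
move=> xy yz; apply: contrapT => /(adm_tight gf)[D [AD Dx xD]].
apply: xD; have : M (Imp (Box (Var 0)) (Box (Box (Var 0)))).
  by case: S4t_axioms S4BP_axioms => [_ T4] [/(_ _ T4)/ML].
move=> /(adm_sound gf)/(_ (fun _ => D) (fun _ => AD) x) /= H.
by apply: (H _ y xy z yz).
Qed.

Lemma general_frame_depth (x y z : W) :
  acc x y -> acc y z -> acc y x \/ acc z y.
Proof.
move=> xy yz; apply: contrapT => /not_orP[].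
move=> /(adm_tight gf)[D1 [AD1 D1y D1x]] /(adm_tight gf)[D0 [AD0 D0z D0y]].
apply: D1x; have : M bd2 by apply: ML; case: S4BP_axioms.
move=> /(adm_sound gf)/(_ (fun p => nth setT [:: D0; D1] p)) H.
have /sat_bd2 : sat (fun p => nth setT [:: D0; D1] p) x bd2.
  by apply: H => -[|[|p]] //=; rewrite nth_nil; apply: (admT gf).
by move=> /(_ y z); apply.
Qed.

(** Tightness thickens a three-element antichain to definable sets that are still incomparable. With
    [D (i, j)] containing the successors of [y i] but not [y j], the set for [i] collects the points
    all of whose successors lie in each [D (i, j)] and which lie outside each [D (j, i)]. *)
Lemma antichain_sets (y : 'I_3 -> W) :
  (forall i j, i != j -> ~ acc (y i) (y j)) ->
  exists V : nat -> set W, [/\ forall p, A (V p), forall i, V (val i) (y i) &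
    forall i j : 'I_3, i != j -> forall z z', V i z -> V j z' -> ~ acc z z'].
Proof.
move=> anti.
have /choice[D HD] : forall ij : 'I_3 * 'I_3, exists D, ij.1 != ij.2 ->
    [/\ A D, forall z, acc (y ij.1) z -> D z & ~ D (y ij.2)].
  move=> [i j] /=; have [->|ij] := eqVneq i j; first by exists setT.
  by have [D HD] := adm_tight gf (anti _ _ ij); exists D.
pose V0 (i : 'I_3) := [set x | forall j, j \in enum 'I_3 -> [set x | j != i ->
  (forall z, acc x z -> D (i, j) z) /\ ~ D (j, i) x] x].
exists (fun p => if insub p is Some i then V0 i else setT); split.
- move=> p; case: insub => [i|]; last exact: (admT gf).
  apply: adm_all => j _; have [->|ji] := eqVneq j i.
    by rewrite (_ : [set _ | _] = setT); [apply: (admT gf)|apply/seteqP; split].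
  rewrite (_ : [set _ | _] = [set x | forall z, acc x z -> D (i, j) z] `\` D (j, i)).
    apply: admD; last by case: (HD (j, i)).
    by apply: (adm_box gf); case: (HD (i, j)) => //=; rewrite eq_sym.
  by apply/seteqP; split=> [x /(_ isT)|x] //= [].
- move=> i; rewrite valK => j _ /= ji; split; last by case: (HD (j, i) ji).
  by case: (HD (i, j)) => //=; rewrite eq_sym.
- move=> i j ij z z'; rewrite !valK => Vz Vz' zz'.
  have [_ nz] : (forall t, acc z t -> D (i, j) t) /\ ~ D (j, i) z.
    by apply: Vz; rewrite ?mem_enum // eq_sym.
  have [_ nz'] : (forall t, acc z' t -> D (j, i) t) /\ ~ D (i, j) z'.
    by apply: Vz'; rewrite ?mem_enum.
  have [H _] : (forall t, acc z t -> D (i, j) t) /\ ~ D (j, i) z.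
    by apply: Vz; rewrite ?mem_enum // eq_sym.
  exact/nz'/H.
Qed.

Lemma general_frame_s4bp : s4bp_frame W.
Proof.
split; [exact: general_frame_refl|exact: general_frame_trans|
  exact: general_frame_depth| |].
- move=> x y xy; apply: contrapT => N.
  have [|V [AV Vy Vanti]] := @antichain_sets y.
    by move=> i j ij yij; apply: N; exists i, j.
  have : M (bw Dia 2) by apply: ML; case: S4BP_axioms.
  move=> /(adm_sound gf)/(_ _ AV x)/(sat_bw _ _ (sat_dia V)) [].
    by move=> i; exists (y i); [apply: xy|apply: Vy].
  move=> i [j [ij [z xz [zi [zj|[z' zz' z'j]]]]]]; last first.
    exact: (Vanti _ _ ij _ _ zi z'j zz').
  exact: (Vanti _ _ ij _ _ zi zj (general_frame_refl z)).
- move=> x y xy; apply: contrapT => N.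
  have [|V [AV Vy Vanti]] := @antichain_sets y.
    by move=> i j ij yij; apply: N; exists i, j.
  have : M (bw PDia 2) by apply: ML; case: S4BP_axioms.
  move=> /(adm_sound gf)/(_ _ AV x)/(sat_bw _ _ (sat_pdia V)) [].
    by move=> i; exists (y i); [apply: xy|apply: Vy].
  move=> i [j [ij [z xz [zi [zj|[z' zz' z'j]]]]]].
    exact: (Vanti _ _ ij _ _ zi zj (general_frame_refl z)).
  by rewrite eq_sym in ij; exact: (Vanti _ _ ij _ _ z'j zi zz').
Qed.

(** By transitivity the set of points whose successors all lie in [D] is closed upwards, hence a
    union of clusters; so the set given by tightness for two points yields one that separates their
    whole clusters. *)
Lemma separated_clusters (x y : W) : ~ (acc x y /\ acc y x) ->
  exists D, [/\ A D, [set z | acc x z /\ acc z x] `<=` D &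
                     [set z | acc y z /\ acc z y] `<=` ~` D].
Proof.
have T := general_frame_trans.
move=> /not_andP[] /(adm_tight gf)[D [AD Dx Dy]].
  exists [set x | forall y, acc x y -> D y]; split; first exact: (adm_box gf).
    by move=> z [xz zx] t zt; apply: Dx; apply: T zt.
  by move=> z [yz zy] H; apply/Dy/H.
exists (~` [set x | forall y, acc x y -> D y]); split.
- exact/(admC gf)/(adm_box gf).
- by move=> z [yz zy] H; apply/Dy/H.
- by move=> z [xz zx] /=; apply => t zt; apply: Dx; apply: T zt.
Qed.

End Admissible.

(** * Paths of clusters *)

Definition clust (F : frame) (x y : F) := acc x y /\ acc y x.
Definition below (F : frame) (x y : F) := acc x y /\ ~ acc y x.
Definition adj (F : frame) (x y : F) := below x y \/ below y x.
Definition bottom (F : frame) (x : F) := exists y, below x y.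

(** Only consecutive clusters are required to be adjacent, and others may be: the two ends are
    adjacent when the path runs round a crown. *)
Definition simple_path (F : frame) (c : nat -> F) (n : nat) : Prop :=
  (forall i, i < n -> adj (c i) (c i.+1)) /\
  (forall i j, i < j -> j <= n -> ~ clust (c i) (c j)).

(** [zig o] is the order of the infinite garland on [nat], in which [0] is
    minimal if [o] holds and maximal otherwise. *)
Definition zig (o : bool) (i j : nat) : Prop :=
  i = j \/ odd i (+) o /\ (j = i.+1 \/ i = j.+1).

(** The order of a finite skeleton: a garland, closed into a crown if [cy]. *)
Definition edge (cy : bool) (n i j : nat) : Prop :=
  [\/ j = i.+1, i = j.+1 | cy /\ (i = 0 /\ j = n \/ i = n /\ j = 0)].

Definition skel (cy o : bool) (n i j : nat) : Prop :=
  i = j \/ odd i (+) o /\ edge cy n i j.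

Section Paths.
Variable F : frame.
Hypothesis FF : s4bp_frame F.
Implicit Types x y z : F.

Let T := fr_trans FF.

Lemma clust_refl x : clust x x.
Proof. by split; apply: fr_refl. Qed.

Lemma clust_sym x y : clust x y -> clust y x.
Proof. by case. Qed.

Lemma clust_trans x y z : clust x y -> clust y z -> clust x z.
Proof. by move=> [xy yx] [yz zy]; split; [apply: T yz|apply: T yx]. Qed.

Lemma acc_clust x x' y y' : clust x x' -> clust y y' -> acc x y -> acc x' y'.
Proof. by move=> [_ x'x] [yy' _] xy; apply: T yy'; apply: T xy. Qed.

Lemma below_clust x x' y y' :
  clust x x' -> clust y y' -> below x y -> below x' y'.
Proof.
move=> xx' yy' [xy yx]; split; first exact: acc_clust xy.
by move=> y'x'; apply: yx; apply: acc_clust y'x'; apply: clust_sym.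
Qed.

Lemma adj_clust x x' y y' : clust x x' -> clust y y' -> adj x y -> adj x' y'.
Proof. by move=> xx' yy' [] H; [left|right]; apply: below_clust H. Qed.

Lemma adj_sym x y : adj x y -> adj y x.
Proof. by case; [right|left]. Qed.

Lemma adj_clustF x y : adj x y -> ~ clust x y.
Proof. by move=> [[xy yx]|[yx xy]] []. Qed.

Lemma below_chain x y z : below x y -> below y z -> False.
Proof. by move=> [xy yx] [yz zy]; case: (fr_depth FF xy yz). Qed.

(** Depth two makes a cluster with neighbours either minimal or maximal, so undirected adjacency
    together with [bottom] determines the order. Hence it is enough to study undirected paths. *)
Lemma below_adj x y : below x y <-> adj x y /\ bottom x.
Proof.
split=> [xy|[[xy|yx] [z xz]]] //; first by split; [left|exists y].
by case: (below_chain yx xz).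
Qed.

Lemma bottom_adj x y : adj x y -> bottom x <-> ~ bottom y.
Proof.
case=> xy; split.
- by move=> _ [z yz]; apply: below_chain xy yz.
- by exists y.
- by case=> z xz; case: (below_chain xy xz).
- by case; exists x.
Qed.

Lemma acc_below x y : acc x y <-> clust x y \/ below x y.
Proof.
split=> [xy|[[]|[]]] //.
by have [yx|yx] := pselect (acc y x); [left|right].
Qed.

(** The neighbours of [x] lie all above it or all below it, so one of the two width conditions makes
    two of them comparable, and depth two then puts these into one cluster. *)
Lemma adj3 x y1 y2 y3 : adj x y1 -> adj x y2 -> adj x y3 ->
  [\/ clust y1 y2, clust y1 y3 | clust y2 y3].
Proof.
pose y (i : 'I_3) := nth y1 [:: y1; y2; y3] i.
move=> a1 a2 a3; have a i : adj x (y i).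
  by case: i => [[|[|[|]]]].
suff [i [j [ij yij]]] : exists i j, i != j /\ clust (y i) (y j).
  case: i j ij yij => [[|[|[|i]]] pi] [[|[|[|j]]] pj] //= _; rewrite /y /= => H;
  by [apply: Or31 | apply: Or32 | apply: Or33 | apply: Or31; apply: clust_sym
    | apply: Or32; apply: clust_sym | apply: Or33; apply: clust_sym].
have [xb|xb] := pselect (bottom x).
  have b i : below x (y i) by apply/below_adj.
  have [|i [j [ij yij]]] := @fr_forth _ FF x y; first by move=> i; case: (b i).
  exists i, j; split=> //; split=> //.
  by have [|//] := fr_depth FF (b i).1 yij => yx; case: (b i).
have b i : below (y i) x.
  by case: (a i) => // H; case: xb; exists (y i).
have [|i [j [ij yij]]] := @fr_back _ FF x y; first by move=> i; case: (b i).
exists i, j; split=> //; split=> //.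
by have [//|] := fr_depth FF yij (b j).1 => yx; case: (b j).
Qed.

Lemma simple_path_rev (c : nat -> F) n :
  simple_path c n -> simple_path (fun i => c (n - i)) n.
Proof.
move=> [cn ci]; split=> [i lin|i j ij jn].
  by rewrite -(subnSK lin); apply/adj_sym/cn; lia.
by move=> /clust_sym; apply: ci; lia.
Qed.

Lemma simple_path_inj (c : nat -> F) n i j :
  simple_path c n -> i <= n -> j <= n -> clust (c i) (c j) -> i = j.
Proof.
move=> [_ ci] lin ljn cij; apply: contrapT => ij.
have [ij'|ij'] : i < j \/ j < i by lia.
  exact: ci cij.
exact: ci (clust_sym cij).
Qed.

Lemma simple_path_interior (c : nat -> F) n i y :
  simple_path c n -> 0 < i < n -> adj (c i) y ->
  clust (c i.-1) y \/ clust (c i.+1) y.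
Proof.
move=> cn lin iy.
have a1 : adj (c i) (c i.-1).
  by case: i lin {iy} => //= i lin; apply/adj_sym; apply: cn.1; lia.
have a2 : adj (c i) (c i.+1) by apply: cn.1; lia.
have [/(simple_path_inj cn)||] := adj3 a1 a2 iy; [|by left|by right].
by lia.
Qed.

Lemma simple_path_bottom (c : nat -> F) n i :
  simple_path c n -> i <= n -> bottom (c i) <-> odd i (+) `[<bottom (c 0)>].
Proof.
move=> cn; elim: i => [|i IH] lin; first by rewrite addFb; split=> /asboolP.
have /bottom_adj H := adj_sym (cn.1 _ lin).
rewrite H IH; last lia.
by rewrite /= addNb; split=> /negP.
Qed.

Definition longest_path (x : F) (c : nat -> F) (n : nat) : Prop :=
  [/\ simple_path c n, exists2 m, m <= n & clust (c m) x &
    forall c' m, simple_path c' n.+1 -> m <= n.+1 -> ~ clust (c' m) x].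

Lemma simple_path_le (c : nat -> F) n m :
  simple_path c n -> m <= n -> simple_path c m.
Proof. by move=> [cn ci] mn; split=> [i|i j ij] H; [apply: cn|apply: ci]; lia. Qed.

Lemma longest_path_exists N : (forall c : nat -> F, ~ simple_path c N) ->
  forall x, exists c n, n < N /\ longest_path x c n.
Proof.
move=> bounded x.
pose P n := `[<exists2 c, simple_path c n & exists2 m, m <= n & clust (c m) x>].
have P0 : exists n, P n.
  exists 0; apply/asboolP; exists (fun _ => x); last by exists 0 => //; apply: clust_refl.
  by split=> // i j; lia.
have PN n : P n -> n <= N.
  move/asboolP => [c cn _]; rewrite leqNgt; apply/negP => Nn.
  by apply: (bounded c); apply: simple_path_le cn _; lia.
case: (ex_maxnP P0 PN) => n /asboolP[c cn cx] nmax.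
exists c, n; split.
  rewrite ltnNge; apply/negP => Nn.
  by apply: (bounded c); apply: simple_path_le cn _; lia.
split=> // c' m c'n mn c'x.
have /nmax : P n.+1 by apply/asboolP; exists c' => //; exists m.
by rewrite ltnn.
Qed.

Lemma longest_path_rev x c n :
  longest_path x c n -> longest_path x (fun i => c (n - i)) n.
Proof.
move=> [cn [m mn cx] max]; split=> //; first exact: simple_path_rev.
by exists (n - m); rewrite ?subKn ?leq_subr.
Qed.

(** A neighbour of the first cluster off the path would prolong it. One at an interior position has
    both its neighbours on the path, so [c 0] is one of these and the position is 1. *)
Lemma longest_path_start x c n y : longest_path x c n -> adj (c 0) y ->
  exists2 j, j <= n & clust (c j) y /\ (j = 1 \/ (1 < n /\ j = n)).
Proof.
move=> [cn [m mn cx] max] cy.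
have [[j jn cjy]|H] := pselect (exists2 j, j <= n & clust (c j) y).
  exists j => //; split=> //; apply: contrapT => Hj.
  have j0 : j <> 0 by move=> E; move: cjy; rewrite E; apply: adj_clustF.
  have cj0 : adj (c j) (c 0).
    by apply: adj_clust (adj_sym cy); [apply: clust_sym|apply: clust_refl].
  have jint : 0 < j < n by lia.
  by have [] := simple_path_interior cn jint cj0 => /(simple_path_inj cn); lia.
have c'n : simple_path (fun i => if i is i'.+1 then c i' else y) n.+1.
  split=> [[|i] // lin|[|i] [|j] // ij jn]; first exact: adj_sym.
  - exact: cn.1.
  - by move=> /clust_sym yj; apply: H; exists j.
  - exact: cn.2.
by case: (max _ m.+1 c'n).
Qed.

Lemma longest_path_closed x c n i y : longest_path x c n -> i <= n ->
  adj (c i) y -> exists2 j, j <= n & clust (c j) y /\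
  edge `[<1 < n /\ adj (c 0) (c n)>] n i j.
Proof.
move=> cl lin ciy; have [cn _ _] := cl.
have [i0|i0] := eqVneq i 0.
  move: ciy; rewrite i0 => ciy.
  have [j jn [cj Hj]] := longest_path_start cl ciy.
  exists j => //; split=> //; case: Hj => [->|[n1 E]]; first exact: Or31.
  apply: Or33; split; last by left.
  apply/asboolP; split=> //; apply: adj_clust ciy; first exact: clust_refl.
  by rewrite -E; apply: clust_sym.
have [i_n|i_n] := eqVneq i n.
  have := longest_path_start (longest_path_rev cl); rewrite subn0 -i_n => /(_ _ ciy).
  move=> [j jn [cj Hj]]; exists (i - j); first lia.
  split=> //; case: Hj => [->|[n1 E]]; first by apply: Or32; lia.
  apply: Or33; split; last by right; lia.
  apply/asboolP; split=> //; rewrite -E subnn in cj; rewrite -E in ciy *.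
  by apply: adj_clust (adj_sym ciy); [apply: clust_sym|apply: clust_refl].
have [|cy|cy] := @simple_path_interior c n i y cn _ ciy; first lia.
  by exists i.-1; [lia|split=> //; apply: Or32; lia].
by exists i.+1; [lia|split=> //; apply: Or31].
Qed.

(** The connected component of [x] is a finite sequence of clusters arranged
    in a garland or a crown. *)
Record component (x : F) (c : nat -> F) (n m : nat) (cy o : bool) : Prop := {
  comp_path : simple_path c n;
  comp_le : m <= n;
  comp_mem : clust (c m) x;
  comp_acc : forall i j, i <= n -> j <= n ->
    acc (c i) (c j) <-> skel cy o n i j;
  comp_closed : forall i y, i <= n -> adj (c i) y ->
    exists2 j, j <= n & clust (c j) y;
  comp_cycle : cy -> 1 < n /\ odd n }.

Lemma component_exists N : (forall c : nat -> F, ~ simple_path c N) ->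
  forall x, exists c n m cy o, n < N /\ component x c n m cy o.
Proof.
move=> bounded x; have [c [n [nN cl]]] := longest_path_exists bounded x.
have [cn [m mn cx] _] := cl.
exists c, n, m, `[<1 < n /\ adj (c 0) (c n)>], `[<bottom (c 0)>]; split=> //.
split=> //.
- move=> i j lin ljn; rewrite acc_below; split.
    move=> [cij|/below_adj[cij ib]]; first by left; apply: (simple_path_inj cn).
    right; split; first by apply/(simple_path_bottom cn).
    have [k kn [ckj e]] := longest_path_closed cl lin cij.
    by rewrite -(simple_path_inj cn kn ljn ckj).
  case=> [->|[ib e]]; [by left; apply: clust_refl|right].
  apply/below_adj; split; last exact/(simple_path_bottom cn).
  case: e => [E|E|[/asboolP[n1 c0n] [] [-> ->]]] //.
  - by rewrite E; apply: cn.1; lia.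
  - by rewrite E; apply/adj_sym/cn.1; lia.
  - exact: adj_sym.
- move=> i y lin ciy; have [k kn [cky _]] := longest_path_closed cl lin ciy.
  by exists k.
(* The ends of a crown are adjacent, hence one is minimal and the other is not; as the kinds
   alternate along the path, [n] is odd. *)
- move=> /asboolP[n1 c0n]; split=> //.
  have /= := bottom_adj c0n.
  have := simple_path_bottom cn (leqnn n).
  have := @simple_path_bottom c n 0 cn (leq0n n).
  by case: (odd n) => //=; case: asboolP => /=; tauto.
Qed.

Lemma component_mem x c n m cy o i y z : component x c n m cy o ->
  i <= n -> clust (c i) y -> acc y z \/ acc z y ->
  exists2 j, j <= n & clust (c j) z.
Proof.
move=> C lin ciy yz.
have [yz'|yz'] : clust y z \/ adj y z.
- by case: yz => /acc_below[] H; [left|right;left|left;apply: clust_sym|right;right].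
- by exists i => //; apply: clust_trans yz'.
apply: (comp_closed C lin); apply: adj_clust yz'; last exact: clust_refl.
exact: clust_sym.
Qed.

End Paths.

(** * Maps from garlands and crowns onto garlands *)

(** A p-morphism for both modalities from a skeleton onto a garland. That [m] alone lies over [m']
    ensures that the fibre of the fat position is a single cluster. *)
Record skel_map (cy o : bool) (n m : nat) (o' : bool) (n' m' : nat)
    (g : nat -> nat) : Prop := {
  sk_le : forall i, i <= n -> g i <= n';
  sk_hom : forall i j, i <= n -> j <= n -> skel cy o n i j ->
    zig o' (g i) (g j);
  sk_forth : forall i j', i <= n -> j' <= n' -> zig o' (g i) j' ->
    exists j, [/\ j <= n, skel cy o n i j & g j = j'];
  sk_back : forall i j', i <= n -> j' <= n' -> zig o' j' (g i) ->
    exists j, [/\ j <= n, skel cy o n j i & g j = j'];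
  sk_onto : forall j', j' <= n' -> exists2 j, j <= n & g j = j';
  sk_center : g m = m';
  sk_fiber : forall i, i <= n -> g i = m' -> i = m }.

Lemma skel_map_id o n m : m <= n -> skel_map false o n m o n m id.
Proof.
move=> mn; split=> // [i j lin ljn|i j lin ljn H|i j lin ljn H|j jn].
- by case=> [->|[b []]]; [left|right; split; auto..|move=> []].
- exists j; split=> //; case: H => [|[b [] e]]; [by left|right; split=> //..].
    by apply: Or31.
  by apply: Or32.
- exists j; split=> //; case: H => [|[b [] e]]; [by left|right; split=> //..].
    by apply: Or31.
  by apply: Or32.
- by exists j.
Qed.

(** Reflection brings a position beyond the middle into the first half. Position 0 of the image is
    the old end [n], whence the orientation [o (+) odd n]. *)
Lemma skel_map_rev o n m : m <= n ->
  skel_map false o n m (o (+) odd n) n (n - m) (fun i => n - i).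
Proof.
move=> mn; split=> [i|i j lin ljn|i j lin ljn H|i j lin ljn H|j jn||i]; try lia.
- by case=> [->|[b []]]; rewrite /zig; lia.
- by exists (n - j); rewrite /zig /skel in H *; split; [lia| |lia];
    case: H => [|[b [] e]]; [left; lia|right; split; first lia; apply: Or32; lia
      |right; split; first lia; apply: Or31; lia].
- by exists (n - j); rewrite /zig /skel in H *; split; [lia| |lia];
    case: H => [|[b [] e]]; [left; lia|right; split; first lia; apply: Or32; lia
      |right; split; first lia; apply: Or31; lia].
- by exists (n - j); lia.
Qed.

(** Folding a garland about its middle point. *)
Lemma skel_map_fold o m :
  skel_map false o m.*2 m (o (+) odd m) m 0 (fun i => (i - m) + (m - i)).
Proof.
split=> [i|i j lin ljn|i j lin ljn H|i j lin ljn H|j jn||i]; try lia.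
- by case=> [->|[b []]]; rewrite /zig; lia.
- have [e|[e|e]] : i = (m + j) \/ (i + j = m) \/
     (odd i (+) o /\ exists2 k, (k <= m.*2 /\ (k = i.+1 \/ i = k.+1))
        & ((k - m) + (m - k)) = j).
  + move: H; rewrite /zig => -[|[b H]]; first by lia.
    have [|] : (i.+1 <= m.*2 /\ ((i.+1 - m) + (m - i.+1)) = j) \/
       (0 < i /\ ((i.-1 - m) + (m - i.-1)) = j) by lia.
      by move=> [? ?]; right; right; split; [lia|exists i.+1 => //; lia].
    by move=> [? ?]; right; right; split; [lia|exists i.-1 => //; lia].
  + by exists i; split; [lia|left|lia].
  + by exists i; split; [lia|left|lia].
  + case: e => b [k [km ki] kj]; exists k; split=> //; right; split=> //.
    by case: ki; [apply: Or31|apply: Or32].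
- have [e|[e|e]] : i = (m + j) \/ (i + j = m) \/
     (~~ (odd i (+) o) /\ exists2 k, (k <= m.*2 /\ (k = i.+1 \/ i = k.+1))
        & ((k - m) + (m - k)) = j).
  + move: H; rewrite /zig => -[|[b H]]; first by lia.
    have [|] : (i.+1 <= m.*2 /\ ((i.+1 - m) + (m - i.+1)) = j) \/
       (0 < i /\ ((i.-1 - m) + (m - i.-1)) = j) by lia.
      by move=> [? ?]; right; right; split; [lia|exists i.+1 => //; lia].
    by move=> [? ?]; right; right; split; [lia|exists i.-1 => //; lia].
  + by exists i; split; [lia|left|lia].
  + by exists i; split; [lia|left|lia].
  + case: e => b [k [km ki] kj]; exists k; split=> //; right; split; first lia.
    by case: ki; [apply: Or32|apply: Or31].
- by exists (m + j); lia.
Qed.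

(** Folding a crown about the axis through [m]. *)
Definition crown_fold (n m i : nat) : nat :=
  minn ((i - m) + (m - i)) (n.+1 - ((i - m) + (m - i))).

(** The four ways for [i] to be at cyclic distance [v] from [m]; in this linear form facts about the
    crown can be left to [lia]. *)
Lemma crown_foldP n m i v : i <= n -> m <= n -> odd n ->
  crown_fold n m i = v <->
  v <= (n.+1)./2 /\
  (i = m + v \/ i + v = m \/ i + n.+1 = m + v \/ i + v = m + n.+1).
Proof. by rewrite /crown_fold => lin mn on; lia. Qed.

Definition crown_next (n i : nat) := if i == n then 0 else i.+1.
Definition crown_prev (n i : nat) := if i == 0 then n else i.-1.

Lemma crown_nextP n i : i <= n -> odd n ->
  [/\ crown_next n i <= n, edge true n i (crown_next n i),
      edge true n (crown_next n i) i & odd (crown_next n i) = ~~ odd i].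
Proof.
rewrite /crown_next; case: eqP => [->|ne] lin on; split=> //; try lia.
- by apply: Or33; split=> //; right.
- by apply: Or33; split=> //; left.
- exact: Or31.
- exact: Or32.
Qed.

Lemma crown_prevP n i : i <= n -> odd n ->
  [/\ crown_prev n i <= n, edge true n i (crown_prev n i),
      edge true n (crown_prev n i) i & odd (crown_prev n i) = ~~ odd i].
Proof.
rewrite /crown_prev; case: eqP => [->|ne] lin on; split=> //; try lia.
- by apply: Or33; split=> //; left.
- by apply: Or33; split=> //; right.
- by apply: Or32; lia.
- by apply: Or31; lia.
Qed.

Lemma crown_fold_step n m i j : i <= n -> m <= n -> odd n ->
  j <= (n.+1)./2 -> j = (crown_fold n m i).+1 \/ crown_fold n m i = j.+1 ->
  crown_fold n m (crown_next n i) = j \/ crown_fold n m (crown_prev n i) = j.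
Proof.
move=> lin mn on jn; have := (crown_foldP _ lin mn on).1 erefl.
move: (crown_fold n m i) => v vP jv.
have [nn _ _ _] := crown_nextP lin on; have [pn _ _ _] := crown_prevP lin on.
rewrite !crown_foldP //.
suff: (crown_next n i = m + j \/ crown_next n i + j = m \/
       crown_next n i + n.+1 = m + j \/ crown_next n i + j = m + n.+1) \/
      (crown_prev n i = m + j \/ crown_prev n i + j = m \/
       crown_prev n i + n.+1 = m + j \/ crown_prev n i + j = m + n.+1) by tauto.
rewrite /crown_prev /crown_next; case: eqP => ?; case: eqP => ?; lia.
Qed.

Lemma crown_fold_edge n m i j : i <= n -> j <= n -> m <= n -> odd n ->
  edge true n i j ->
  crown_fold n m j = (crown_fold n m i).+1 \/
  crown_fold n m i = (crown_fold n m j).+1.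
Proof.
move=> lin ljn mn on.
have := (crown_foldP _ lin mn on).1 erefl; move: (crown_fold n m i) => v vP.
have := (crown_foldP _ ljn mn on).1 erefl; move: (crown_fold n m j) => w wP.
by case=> [e|e|[_ [[e e']|[e e']]]]; lia.
Qed.

Lemma crown_fold_odd n m i : i <= n -> m <= n -> odd n ->
  odd (crown_fold n m i) = odd i (+) odd m.
Proof.
move=> lin mn on; have := (crown_foldP _ lin mn on).1 erefl.
by move: (crown_fold n m i) => v; lia.
Qed.

Lemma skel_map_crown o n m : m <= n -> odd n ->
  skel_map true o n m (o (+) odd m) (n.+1)./2 0 (crown_fold n m).
Proof.
move=> mn on.
split=> [i lin|i j lin ljn|i j lin ljn H|i j lin ljn H|j jn||i lin].
- by have [] := (crown_foldP _ lin mn on).1 erefl.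
- case=> [->|[b /(crown_fold_edge lin ljn mn on) e]]; [by left|right].
  by rewrite crown_fold_odd //; split=> //; lia.
- case: H => [<-|]; first by exists i; split=> //; left.
  rewrite crown_fold_odd // => -[b /(crown_fold_step lin mn on ljn)[] E].
  + have [? ? ? ?] := crown_nextP lin on.
    by exists (crown_next n i); split=> //; right; split=> //; lia.
  + have [? ? ? ?] := crown_prevP lin on.
    by exists (crown_prev n i); split=> //; right; split=> //; lia.
- case: H => [->|[b H]]; first by exists i; split=> //; left.
  have oi := crown_fold_odd lin mn on.
  have E : j = (crown_fold n m i).+1 \/ crown_fold n m i = j.+1 by lia.
  case: (crown_fold_step lin mn on ljn E) => E'.
  + have [? ? ? ?] := crown_nextP lin on.
    by exists (crown_next n i); split=> //; right; split=> //; lia.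
  + have [? ? ? ?] := crown_prevP lin on.
    by exists (crown_prev n i); split=> //; right; split=> //; lia.
- have [le|le] : m + j <= n \/ n < m + j by lia.
    by exists (m + j) => //; apply/crown_foldP => //; split=> //; left.
  have jmn : m + j - n.+1 <= n by lia.
  exists (m + j - n.+1) => //; apply/crown_foldP => //.
  by split=> //; lia.
- by apply/crown_foldP => //; split=> //; lia.
- by move/crown_foldP => [] // _; lia.
Qed.

Lemma skel_map_exists (cy o : bool) (n m : nat) : m <= n -> (cy -> 1 < n /\ odd n) ->
  exists o' n' m' g, [/\ n' <= n, m' <= n', 2 * m' < n' \/ n' = 0 &
    skel_map cy o n m o' n' m' g].
Proof.
move=> mn; case: cy => [[]// n1 on|_].
  do 4 eexists; split; last exact: skel_map_crown; lia.
have [lt|[E|gt]] : 2 * m < n \/ n = m.*2 \/ n < 2 * m by lia.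
- by do 4 eexists; split; last exact: skel_map_id; lia.
(* The fold moves the middle to position 0 of a garland with end [m]. A single cluster also falls
   under this case, with [m = 0], and accounts for the alternative [n' = 0]. *)
- rewrite E; do 4 eexists; split; last exact: skel_map_fold; lia.
- by do 4 eexists; split; last exact: skel_map_rev; lia.
Qed.

(** * Logics with long paths or large clusters *)

(** [gar false n] and [gar true n] are convertible to [garland n] and its inverse, so one family
    treats both orientations. *)
Definition gar (o : bool) (n : nat) : frame :=
  Frame (fun i j : 'I_n.+1 => if o then Rz (Posz j) (Posz i)
                              else Rz (Posz i) (Posz j)) (inhabits ord0).

Lemma Rz_zig (i j : nat) :
  Rz (Posz i) (Posz j) <-> i = j \/ odd i /\ (j = i.+1 \/ i = j.+1).
Proof.
split=> [[|[k []]|[k []]]|]; [lia|lia|lia|].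
case=> [->|[oi [->|E]]]; first exact: Or31.
  by apply: Or33; exists (Posz i./2); lia.
by apply: Or32; exists (Posz i./2); lia.
Qed.

Lemma gar_acc o n (i j : gar o n) : acc i j <-> zig o i j.
Proof. by case: o i j => i j; rewrite /= Rz_zig /zig; lia. Qed.

Definition pos (o : bool) (n : nat) (m : 'I_n.+1)
  (u : blowup (gar o n) m nat) : nat := @blowup_proj (gar o n) m nat u.

Lemma pos_acc o n (m : 'I_n.+1) (u v : blowup (gar o n) m nat) :
  acc u v <-> zig o (pos u) (pos v).
Proof. exact: gar_acc. Qed.

Lemma pos_le o n (m : 'I_n.+1) (u : blowup (gar o n) m nat) : pos u <= n.
Proof. by rewrite -ltnS; apply: ltn_ord. Qed.

(** Only finitely many truth assignments to the first [k] variables exist, and [h] picks a point for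
    each one that occurs in [S]. *)
Lemma finite_types (X : Type) (V : nat -> set X) (k : nat) (S : set X) (x0 : X) :
  S x0 -> exists (h : nat -> X) (K : nat), (forall i, S (h i)) /\
  forall v, S v -> exists2 i, i <= K & forall p, p < k -> V p v <-> V p (h i).
Proof.
move=> Sx0; pose ty v := [ffun p : 'I_k => `[<V p v>]].
pose s := enum {ffun 'I_k -> bool}.
have /choice[h hP] : forall i, exists u, S u /\
    forall v, S v -> ty v = nth [ffun=> false] s i -> ty u = ty v.
  move=> i; have [[u Su uE]|H] := pselect (exists2 u, S u & ty u = nth [ffun=> false] s i).
    by exists u; split=> // v _ ->.
  by exists x0; split=> // v Sv vE; case: H; exists v.
exists h, (size s); split=> [i|v Sv]; first by case: (hP i).
have vs : ty v \in s by rewrite mem_enum.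
exists (index (ty v) s); first exact: index_size.
move=> p pk; have [_ /(_ v Sv)] := hP (index (ty v) s); rewrite nth_index // => H.
have /(congr1 (fun f : {ffun 'I_k -> bool} => f (Ordinal pk))) := H erefl.
by rewrite !ffunE => E; split=> /asboolP; [rewrite -E|rewrite E] => /asboolP.
Qed.

(** [rho] maps a closed part [C] of [W] onto the garland with [n.+1] points so
    that the fibre over [m] is a cluster with more than [K] points. *)
Record collapses (W : frame) (A : set (set W)) (o : bool) (n m K : nat)
    (C : set W) (rho : W -> nat) (u : nat -> W) : Prop := {
  col_le : forall x, rho x <= n;
  col_adm : forall i, A [set x | rho x = i];
  col_closed : forall x y, C x -> acc x y \/ acc y x -> C y;
  col_hom : forall x y, C x -> C y -> acc x y -> zig o (rho x) (rho y);
  col_forth : forall x j, C x -> j <= n -> zig o (rho x) j ->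
    exists y, [/\ C y, acc x y & rho y = j];
  col_back : forall x j, C x -> j <= n -> zig o j (rho x) ->
    exists y, [/\ C y, acc y x & rho y = j];
  col_onto : forall j, j <= n -> exists2 x, C x & rho x = j;
  col_clust : forall x y, C x -> C y -> rho x = m -> rho y = m -> acc x y;
  col_big : forall i, i <= K -> C (u i) /\ rho (u i) = m;
  col_inj : forall i j, i <= K -> j <= K -> u i = u j -> i = j }.

Definition collapsible (W : frame) (A : set (set W)) (o : bool) (n m K : nat) :=
  exists C rho u, @collapses W A o n m K C rho u.

Lemma int_same_parity (v : int) (t : nat) (b : bool) :
  odd t (+) b = odd `|v|%N -> exists q : int, (v = 2 * q + Posz t + Posz b)%R.
Proof. by move=> H; exists ((v - Posz t - Posz b) %/ 2)%Z; lia. Qed.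

(** * Transferring refutations to the canonical frame *)

Section Collapse.
Variables (M : set form) (W : frame) (A : set (set W)).
Hypothesis gf : general_frame M A.
Hypothesis ML : S4BP `<=` M.

Let FF := general_frame_s4bp gf ML.

(** For a given valuation the infinite cluster shows finitely many types, represented by [h 0], ...,
    [h K]; a cluster of [W] with more than [K] points has room for all of them. Pulling the
    valuation back along [rep] gives a definable valuation and a bisimulation for the variables of
    [a]. *)
Lemma collapsible_sub (o : bool) (n : nat) (m : 'I_n.+1) :
  (forall K, collapsible A o n m K) -> M `<=` Log (blowup (gar o n) m nat).
Proof.
move=> col a Ma V v.
pose F := blowup (gar o n) m nat.
pose S : set F := [set w | pos w = m].
have [h [K [hS hK]]] := @finite_types F V (var_bound a) S (inl m) erefl.
have [C [rho [u [rn rA Cc hom forth back onto cl big inj]]]] := col K.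
have [e [eu eK eA]] : exists e : W -> nat,
    [/\ forall i x, i <= K -> [set u i] x -> e x = i, forall x, e x <= K
      & forall i, A [set x | e x = i]].
  apply: (separating_function gf) => i j iK jK ij.
  by apply: (separated_points gf) => /(inj _ _ iK jK).
(* [e] is prescribed at the points [u i] only, which makes every [h i] with [i <= K] occur. At any
   other point over [m] it still names some [h i], a point of the fat cluster. *)
pose rep (x : W) : F := if rho x == m then h (e x) else inl (inord (rho x)).
have pos_rep x : pos (rep x) = rho x.
  rewrite /rep; case: eqP => [->|_]; first exact: hS.
  by rewrite /pos /= inordK // ltnS.
have repE (w : F) x : rho x = pos w -> pos w <> m -> rep x = w.
  move=> E wm; rewrite /rep E; case: eqP => // _.
  by case: w wm {E} => //= i _; rewrite /pos /= inord_val.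
pose agree (w w' : F) := forall p, p < var_bound a -> V p w <-> V p w'.
pose Z (d : nat) (x : W) (w : F) := [/\ C x, pos w = rho x & agree (rep x) w].
have point w : exists2 x, Z 0 x w & forall y, C y -> rho y = pos w ->
    (pos w = m -> acc x y /\ acc y x).
  have [wm|wm] := pselect (pos w = m).
    have [i iK wi] := hK w wm; have [Cu ru] := big i iK.
    exists (u i); last by move=> y Cy ry _; split; apply: cl => //; rewrite ry.
    split=> //; first by rewrite ru.
    by move=> p pk; rewrite /rep ru eqxx (eu i) // -wi.
  have [x Cx rx] := onto (pos w) (pos_le w).
  by exists x => //; split=> //; rewrite /agree (repE w).
(* [col_forth] and [col_back] reach the right position only; the right type is then found within the
   same cluster. *)
have match_up (w : F) y : C y -> rho y = pos w ->
    exists2 x, Z 0 x w & acc x y /\ acc y x.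
  move=> Cy ry; have [wm|wm] := pselect (pos w = m).
    by have [x xw H] := point w; exists x => //; apply: H.
  exists y; last by split; apply: (fr_refl FF).
  by split=> //; rewrite /agree (repE w).
have [x xv _] := point v.
have AU p : A [set x | V p (rep x)].
  rewrite (_ : [set _ | _] =
    ([set x | rho x = m] `&` [set x | V p (h (e x))]) `|`
    ([set x | rho x <> m] `&` [set x | V p (inl (inord (rho x)))])).
    apply: (admU gf); apply: (admI gf).
    - exact: rA.
    - exact: (adm_preimage gf (fun i => V p (h i)) eK eA).
    - exact: (adm_preimage gf (fun i => i <> m) rn rA).
    - exact: (adm_preimage gf (fun i => V p (inl (inord i))) rn rA).
  apply/seteqP; split=> z /=; rewrite /rep; case: eqP => zm; by [left|right|case=> -[]].
have := @bisim_sat W F (fun p => [set x | V p (rep x)]) V (var_bound a) Z.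
move=> /(_ _ _ _ a (depth a) x v (leqnn _) (leqnn _) xv) [].
- by move=> d y w [_ _ yw] p /yw.
- move=> d y w [Cy ry yw]; split=> [z yz|z /pos_acc wz].
    have Cz : C z by apply: Cc Cy _; left.
    exists (rep z); last by split.
    by apply/pos_acc; rewrite pos_rep ry; apply: hom.
  rewrite ry in wz; have [y' [Cy' yy' ry']] := forth _ _ Cy (pos_le z) wz.
  have [z' z'z [_ y'z']] := match_up z y' Cy' ry'.
  by exists z' => //; apply: (fr_trans FF) yy' y'z'.
- move=> d y w [Cy ry yw]; split=> [z yz|z /pos_acc wz].
    have Cz : C z by apply: Cc Cy _; right.
    exists (rep z); last by split.
    by apply/pos_acc; rewrite pos_rep ry; apply: hom.
  rewrite ry in wz; have [y' [Cy' yy' ry']] := back _ _ Cy (pos_le z) wz.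
  have [z' z'z [z'y' _]] := match_up z y' Cy' ry'.
  by exists z' => //; apply: (fr_trans FF) z'y' yy'.
- by move=> + _; apply; apply: (adm_sound gf Ma AU).
Qed.

Lemma component_position (x : W) c n m cy o : component x c n m cy o ->
  exists e : W -> nat, [/\ forall i y, i <= n -> clust (c i) y -> e y = i,
    forall y, e y <= n & forall i, A [set y | e y = i]].
Proof.
move=> C; apply: (separating_function gf) => i j lin ljn ij.
apply: (separated_clusters gf ML) => cij.
by apply: ij; apply: (simple_path_inj (comp_path C)).
Qed.

Lemma component_collapses (x : W) c n m cy o o' n' m' g K (u : nat -> W) :
  component x c n m cy o -> skel_map cy o n m o' n' m' g ->
  (forall i, i <= K -> clust x (u i)) ->
  (forall i j, i <= K -> j <= K -> u i = u j -> i = j) ->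
  collapsible A o' n' m' K.
Proof.
move=> C G xu uinj; have [e [ec en eA]] := component_position C.
have cE i y : i <= n -> clust (c i) y -> e y = i by exact: ec.
have acE i j y z : i <= n -> j <= n -> clust (c i) y -> clust (c j) z ->
    acc y z <-> skel cy o n i j.
  move=> lin ljn iy jz; rewrite -(comp_acc C lin ljn).
  split; apply: (acc_clust FF) => //; exact: clust_sym.
exists [set y | exists2 i, i <= n & clust (c i) y], (g \o e), u; split=> /=.
- by move=> y; apply: (sk_le G).
- by move=> i; apply: (adm_preimage gf (fun j => g j = i) en eA).
- by move=> y z [i lin iy] yz; apply: (component_mem FF C lin iy yz).
- move=> y z [i lin iy] [j ljn jz] /(acE _ _ _ _ lin ljn iy jz) ij.
  by rewrite (ec i) // (ec j) //; apply: (sk_hom G).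
- move=> y j [i lin iy] jn; rewrite (ec i) // => /(sk_forth G lin jn).
  move=> [k [kn ik <-]]; exists (c k); split.
  + by exists k => //; apply: (clust_refl FF).
  + by apply/(acE i k) => //; apply: (clust_refl FF).
  + by rewrite (ec k) //; apply: (clust_refl FF).
- move=> y j [i lin iy] jn; rewrite (ec i) // => /(sk_back G lin jn).
  move=> [k [kn ik <-]]; exists (c k); split.
  + by exists k => //; apply: (clust_refl FF).
  + by apply/(acE k i) => //; apply: (clust_refl FF).
  + by rewrite (ec k) //; apply: (clust_refl FF).
- move=> j /(sk_onto G)[k kn <-]; exists (c k).
    by exists k => //; apply: (clust_refl FF).
  by rewrite (ec k) //; apply: (clust_refl FF).
- move=> y z [i lin iy] [j ljn jz]; rewrite (ec i) // (ec j) //.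
  move=> /(sk_fiber G lin) E /(sk_fiber G ljn) E'.
  by apply/(acE i j) => //; left; rewrite E E'.
- move=> i iK; have mu : clust (c m) (u i).
    by apply: (clust_trans FF (comp_mem C)); apply: xu.
  split; first by exists m => //; apply: (comp_le C).
  by rewrite (ec m) //; [apply: (sk_center G)|apply: (comp_le C)].
- exact: uinj.
Qed.

(** Pigeonhole over the finitely many shapes [(o, n, m)]: if each failed at some size [k t], a
    cluster with more points than every [k t] would contradict the failure of its own shape. *)
Lemma bounded_paths_sub N : (forall c : nat -> W, ~ simple_path c N) ->
  (forall K, exists (x : W) (u : nat -> W), (forall i, i <= K -> clust x (u i)) /\
     forall i j, i <= K -> j <= K -> u i = u j -> i = j) ->
  exists o n (m : 'I_n.+1), (2 * m < n \/ n = 0) /\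
    M `<=` Log (blowup (gar o n) m nat).
Proof.
move=> bounded big; apply: contrapT => H.
pose Q (t : bool * 'I_N.+1 * 'I_N.+1) K :=
  let: (o, n, m) := t in [/\ m <= n, 2 * m < n \/ n = 0 :> nat &
    collapsible A o n m K].
have /choice[k kP] : forall t, exists K, ~ Q t K.
  move=> [[o n] m]; apply: contrapT => all; apply: H.
  have {}all K : Q (o, n, m) K by apply: contrapT => ?; apply: all; exists K.
  have [mn Hmn _] := all 0.
  exists o, n, (Ordinal (mn : m < n.+1)); split=> //.
  by apply: collapsible_sub => K; case: (all K).
have [x [u [xu uinj]]] := big (\max_t k t).
have [c [n [m [cy [o [nN C]]]]]] := component_exists FF bounded x.
have [o' [n' [m' [g [n'n m'n' Hm G]]]]] :=
  skel_map_exists o (comp_le C) (comp_cycle C).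
have n'N : n' < N.+1 by lia.
have m'N : m' < N.+1 by lia.
apply: (kP (o', Ordinal n'N, Ordinal m'N)); split=> //=.
have kle := leq_bigmax (F := k) (o', Ordinal n'N, Ordinal m'N).
apply: (component_collapses (u := u) C G).
  by move=> i ik; apply: xu; apply: leq_trans ik kle.
by move=> i j ik jk; apply: uinj; [apply: leq_trans ik kle|apply: leq_trans jk kle].
Qed.

Lemma long_paths_sub_Ga :
  (forall n, exists c : nat -> W, simple_path c n) -> M `<=` Ga.
Proof.
move=> long a Ma V v; pose d := depth a.
(* With this length both middle positions, [d] and [d.+1], have [d] steps of the path on either
   side; the parity of [v] decides between them, so that [c t] is minimal exactly when [v] is. *)
have [c cn] := long d.*2.+1; set n := d.*2.+1 in cn.
pose b0 := `[<bottom (c 0)>].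
pose t := if odd d (+) b0 == odd `|v|%N then d else d.+1.
have tv : odd t (+) b0 = odd `|v|%N by rewrite /t; case: eqP; lia.
have [q vq] := int_same_parity tv.
have td : d <= t <= d.+1 by rewrite /t; case: ifP; lia.
have [e [ec en eA]] : exists e : W -> nat,
    [/\ forall i y, i <= n -> clust (c i) y -> e y = i,
    forall y, e y <= n & forall i, A [set y | e y = i]].
  apply: (separating_function gf) => i j lin ljn ij.
  apply: (separated_clusters gf ML) => cij.
  by apply: ij; apply: (simple_path_inj cn).
pose f (i : nat) : garlandZ := (v + Posz i - Posz t)%R.
(* With [k] steps left, position [i] is within [d - k] of [t]; so it is interior to the path as long
   as a step remains. *)
pose Z (k : nat) (x : W) (w : garlandZ) := exists i : nat,
  [/\ clust (c i) x, w = f i, t <= i + d - k, i + k <= t + d & k <= d].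
have ft : v = f t by rewrite /f; lia.
have Zt : Z d (c t) v.
  by exists t; split=> //; by [apply: (clust_refl FF)|lia].
have AU p : A [set x | V p (f (e x))].
  exact: (adm_preimage gf (fun i => V p (f i)) en eA).
have := @bisim_sat W garlandZ (fun p => [set x | V p (f (e x))]) V (var_bound a) Z.
have zigR i j : Rz (f i) (f j) <-> zig b0 i j.
  rewrite /zig; split=> [[|[k []]|[k []]]|[->|[b E]]]; rewrite /f.
  - lia.
  - lia.
  - lia.
  - exact: Or31.
  - case: E => E.
      by apply: Or33; exists (q + Posz (i + b0)./2)%R; lia.
    by apply: Or32; exists (q + Posz (i + b0)./2)%R; lia.
have near_acc i j x y : i <= n -> j <= n -> (j = i.+1 \/ i = j.+1 \/ i = j) ->
    clust (c i) x -> clust (c j) y -> acc x y <-> zig b0 i j.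
  move=> lin ljn ij ix jy.
  have -> : acc x y <-> acc (c i) (c j).
    by split; apply: (acc_clust FF) => //; apply: clust_sym.
  rewrite acc_below; split.
    case=> [/(simple_path_inj cn lin ljn)->|]; first by left.
    move=> /(below_adj FF)[a1 /(simple_path_bottom FF cn lin) b1].
    by case: ij => [E|[E|E]]; [right; auto|right; auto|left].
  case=> [->|[b1 E]]; first by left; apply: (clust_refl FF).
  right; apply/(below_adj FF); split; last exact/(simple_path_bottom FF cn lin).
  case: E => E; rewrite E; first by apply: cn.1; lia.
  by apply: adj_sym; apply: cn.1; lia.
have nbr i x y : 0 < i < n -> clust (c i) x -> acc x y \/ acc y x ->
    exists2 j, clust (c j) y & (j = i.+1 \/ i = j.+1 \/ i = j).
  move=> lin ix xy; have [xy'|xy'] : clust x y \/ adj x y.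
  - case: xy => /acc_below[] H; [by left|by right;left|
      by left; apply: clust_sym|by right;right].
  - by exists i; [apply: (clust_trans FF) xy'|right; right].
  have ciy : adj (c i) y.
    by apply: (adj_clust FF) xy'; [apply: clust_sym|apply: (clust_refl FF)].
  have [H|H] := simple_path_interior FF cn lin ciy.
    by exists i.-1 => //; lia.
  by exists i.+1 => //; lia.
move=> /(_ _ _ _ a d (c t) v (leqnn _) (leqnn _) Zt) [].
- move=> k x w [i [ix -> ti it kd]] p _ /=.
  by rewrite (ec i) //; lia.
- move=> k x w [i [ix -> ti it kd]]; have lin : 0 < i < n by lia.
  split=> [y xy|w' /=].
    have [j jy ij] := nbr i x y lin ix (or_introl xy).
    exists (f j); last by exists j; split=> //; lia.
    by apply/zigR/(near_acc i j x y) => //; lia.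
  move=> iw'; have [j Ej] : exists2 j : nat, w' = f j &
      (j = i.+1 \/ i = j.+1 \/ i = j).
    case: iw' => [E|[r [E1 E2]]|[r [E1 E2]]]; move: E1 E2 || move: E; rewrite /f.
    + by exists i; rewrite -?E; auto.
    + by exists i.-1; lia.
    + by exists i.+1; lia.
  move=> ij; rewrite Ej in iw' *; exists (c j).
    by apply/(near_acc i j) => //; [lia|lia|apply: (clust_refl FF)|apply/zigR].
  by exists j; split=> //; by [apply: (clust_refl FF)|lia].
- move=> k x w [i [ix -> ti it kd]]; have lin : 0 < i < n by lia.
  split=> [y xy|w' /=].
    have [j jy ij] := nbr i x y lin ix (or_intror xy).
    exists (f j); last by exists j; split=> //; lia.
    by apply/zigR/(near_acc j i y x) => //; lia.
  move=> iw'; have [j Ej] : exists2 j : nat, w' = f j &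
      (j = i.+1 \/ i = j.+1 \/ i = j).
    case: iw' => [E|[r [E1 E2]]|[r [E1 E2]]]; move: E1 E2 || move: E; rewrite /f.
    + by exists i; rewrite ?E; auto.
    + by exists i.+1; lia.
    + by exists i.-1; lia.
  move=> ij; rewrite Ej in iw' *; exists (c j).
    by apply/(near_acc j i) => //; [lia|lia|lia|apply: (clust_refl FF)|apply/zigR].
  by exists j; split=> //; by [apply: (clust_refl FF)|lia].
- by move=> + _; apply; apply: (adm_sound gf Ma AU).
Qed.

End Collapse.

(** * Bounded components *)

Lemma In_map (I : eqType) (X : Type) (u : I -> X) (s : seq I) (i : I) :
  i \in s -> List.In (u i) [seq u j | j <- s].
Proof.
elim: s => // j s IH; rewrite in_cons => /orP[/eqP->|/IH]; by [left|right].
Qed.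

(** A repetition-free sequence in [S] of greatest possible length lists [S], as a missing element
    would prolong it. *)
Lemma finite_cover (X : Type) (S : set X) (K : nat) :
  (forall u : nat -> X, (forall i, i <= K -> S (u i)) ->
     ~ forall i j, i <= K -> j <= K -> u i = u j -> i = j) ->
  exists2 l : seq X, size l <= K & forall y, S y -> List.In y l.
Proof.
elim: K => [|K IH] H.
  exists [::] => // y Sy; case: (H (fun _ => y)) => // i j i0 j0 _; lia.
have [[u [Su ui]]|N] := pselect (exists u : nat -> X,
    (forall i, i <= K -> S (u i)) /\
    forall i j, i <= K -> j <= K -> u i = u j -> i = j).
  exists [seq u i | i <- iota 0 K.+1]; first by rewrite size_map size_iota.
  move=> y Sy; apply: contrapT => yl.
  have yu i : i <= K -> y <> u i.
    by move=> iK E; apply: yl; rewrite E; apply: In_map; rewrite mem_iota.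
  apply: (H (fun i => if i == K.+1 then y else u i)) => [i iK|i j iK jK].
    by case: eqP => // ?; apply: Su; lia.
  case: eqP => [->|ni]; case: eqP => [->|nj] //.
  - by move=> /yu; lia.
  - by move=> /esym/yu; lia.
  - by apply: ui; lia.
have [u Su ui|l lK lS] := IH; first by apply: N; exists u.
by exists l => //; apply: leqW.
Qed.

Section Tabular.
Variables (M : set form) (W : frame) (A : set (set W)).
Hypothesis MT : tense_logic M.
Hypothesis gf : general_frame M A.
Hypothesis ML : S4BP `<=` M.

Let FF := general_frame_s4bp gf ML.

Section Tables.
Variable B : nat.

(** Relations coded as Boolean matrices form a finite type, so the disjoint union of all these
    frames is finite: tabularity asks for one finite frame, not a finite set of them. *)
Definition table := {ffun 'I_B.+1 * 'I_B.+1 -> bool}.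

Definition table_frame (r : table) : frame :=
  Frame (fun i j : 'I_B.+1 => r (i, j)) (inhabits ord0).

Definition table_valid (t : table * 'I_B.+1) : bool :=
  `[<forall a, M a -> forall V, @sat (table_frame t.1) V t.2 a>].

(** The points, in all frames on ['I_B.+1], at which [M] is valid; by
    necessitation they form a closed part of the disjoint union. *)
Definition tables := {t : table * 'I_B.+1 | table_valid t}.

Definition tables_acc (s t : tables) : Prop :=
  (val s).1 = (val t).1 /\ (val s).1 ((val s).2, (val t).2).

Lemma table_valid_next (r : table) (i j : 'I_B.+1) :
  r (i, j) || r (j, i) -> table_valid (r, i) -> table_valid (r, j).
Proof.
move=> ij /asboolP iv; apply/asboolP => a Ma V; case/orP: ij => ij.
  exact: (iv _ (Box_nec MT Ma) V j ij).
apply: contrapT => Na; apply: (iv _ (H_nec MT Ma) V).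
by exists j.
Qed.

(** The points of a table that are left out are not adjacent to those kept, by [table_valid_next],
    so leaving them out does not affect truth. *)
Lemma tables_sat (ht : inhabited tables) (U : nat -> set (Frame tables_acc ht))
    (r : table) (V : nat -> set (table_frame r)) :
  (forall (s : tables) j p, val s = (r, j) -> U p s <-> V p j) ->
  forall (s : tables) j a, val s = (r, j) -> sat (F := Frame tables_acc ht) U s a <-> sat V j a.
Proof.
move=> UV s j a sj.
apply: (@bisim_sat (Frame tables_acc ht) (table_frame r) U V (var_bound a)
  (fun _ (s : tables) j => val s = (r, j)) _ _ _ a (depth a)) => // {s j sj}.
- by move=> _ s j sj p _; apply: UV.
- move=> _ s j sj; split=> [s' [ss' ss'a]|k jk].
    rewrite sj /= in ss' ss'a; exists (val s').2; first exact: ss'a.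
    by move: ss' => /= ->; case: (val s').
  have kv : table_valid (r, k).
    by apply: (@table_valid_next r j k); [rewrite jk|rewrite -sj; exact: (svalP s)].
  by exists (exist _ (r, k) kv) => //; split; rewrite sj.
- move=> _ s j sj; split=> [s' [ss' ss'a]|k jk].
    rewrite sj /= in ss' ss'a; exists (val s').2; first by move: ss' ss'a => /= ->.
    by move: ss' => /= <-; case: (val s').
  have kv : table_valid (r, k).
    by apply: (@table_valid_next r j k); [rewrite jk orbT|rewrite -sj; exact: (svalP s)].
  by exists (exist _ (r, k) kv) => //; split; rewrite sj.
Qed.

Lemma tables_sound (ht : inhabited tables) : M `<=` Log (Frame tables_acc ht).
Proof.
move=> a Ma U t; have /asboolP/(_ a Ma) := svalP t.
move=> /(_ (fun p => [set j | exists2 s : tables, val s = ((val t).1, j) & U p s])).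
move/tables_sat; apply; last exact: surjective_pairing.
move=> s j p sj; split=> [Us|[s' s'j]]; first by exists s.
by have -> : s' = s by apply: val_inj; rewrite s'j.
Qed.

(** The finite closed part [C] is copied into a table. Its points are separated by sets in [A], so
    every valuation on the copy comes from a definable one, which makes [M] valid at the copy of
    [x]. *)
Lemma table_embedding (C : set W) (l : seq W) :
  (forall x y, C x -> acc x y \/ acc y x -> C y) ->
  size l <= B -> (forall y, C y -> List.In y l) ->
  forall x, C x -> forall V a, ~ sat V x a -> (forall p, A (V p)) ->
  exists (t : tables) (V' : nat -> set (table_frame (val t).1)),
    ~ @sat (table_frame (val t).1) V' (val t).2 a.
Proof.
move=> Cc lB lC x Cx V a Na AV.
have /choice[idx idxP] : forall y, exists i, i <= B /\ (C y -> List.nth i l x = y).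
  move=> y; have [Cy|Cy] := pselect (C y); last by exists 0.
  have [i [il E]] := List.In_nth l y x (lC y Cy); exists i; split=> //.
  by apply: leq_trans lB; apply/ltnW/ltP.
have idxB y : idx y < B.+1 by rewrite ltnS; case: (idxP y).
have idxI y z : C y -> C z -> idx y = idx z -> y = z.
  by move=> Cy Cz E; rewrite -((idxP y).2 Cy) E (idxP z).2.
pose f y : 'I_B.+1 := Ordinal (idxB y).
have fI y z : C y -> C z -> f y = f z -> y = z.
  by move=> Cy Cz /(congr1 val); apply: idxI.
(* Indices outside the image of [C] are related to nothing, so the image is closed in the table. *)
pose r : table := [ffun ij =>
  `[<exists y z, [/\ C y, C z, f y = ij.1, f z = ij.2 & acc y z]>]].
have rP y z : C y -> C z -> r (f y, f z) <-> acc y z.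
  move=> Cy Cz; rewrite ffunE; split=> [/asboolP[y' [z' [Cy' Cz' /= yy' zz' ?]]]|yz].
    by rewrite -(fI y' y) // -(fI z' z).
  by apply/asboolP; exists y, z.
have rC y j : C y -> r (f y, j) || r (j, f y) -> exists2 z, C z & f z = j.
  move=> Cy; rewrite !ffunE => /orP[] /asboolP[y' [z' [Cy' Cz' /= yy' zz' ?]]].
    by exists z'.
  by exists y'.
have transfer (U : nat -> set W) (V' : nat -> set (table_frame r)) b :
    (forall p y, C y -> U p y <-> V' p (f y)) ->
    forall y, C y -> sat U y b <-> @sat (table_frame r) V' (f y) b.
  move=> UV y Cy.
  apply: (@bisim_sat W (table_frame r) U V' (var_bound b)
    (fun _ y j => C y /\ f y = j) _ _ _ b (depth b)) => //.
  - by move=> _ z j [Cz <-] p _; apply: UV.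
  - move=> _ z j [Cz <-]; split=> [z' zz'|k zk].
      have Cz' : C z' by apply: Cc Cz _; left.
      by exists (f z') => //; apply/rP.
    have [|z' Cz' fz'] := @rC z k Cz; first by apply/orP; left.
    by exists z' => //; apply/rP => //; rewrite fz'.
  - move=> _ z j [Cz <-]; split=> [z' zz'|k zk].
      have Cz' : C z' by apply: Cc Cz _; right.
      by exists (f z') => //; apply/rP.
    have [|z' Cz' fz'] := @rC z k Cz; first by apply/orP; right.
    by exists z' => //; apply/rP => //; rewrite fz'.
have valid : table_valid (r, f x).
  apply/asboolP => b Mb V'.
  have [e [ec eB eA]] : exists e : W -> nat, [/\
      forall i y, i <= B -> (C y /\ idx y = i) -> e y = i,
      forall y, e y <= B & forall i, A [set y | e y = i]].
    apply: (separating_function gf (S := fun i => [set y | C y /\ idx y = i])) => i j iB jB ij.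
    have [[y [Cy yi]]|Ni] := pselect (exists y, C y /\ idx y = i); last first.
      exists set0; split; [exact: (adm0 gf)| |by move=> ? _ []].
      by move=> y [Cy yi]; case: Ni; exists y.
    have [[z [Cz zj]]|Nj] := pselect (exists y, C y /\ idx y = j); last first.
      exists setT; split; [exact: (admT gf)|by []|].
      by move=> z [Cz zj]; case: Nj; exists z.
    have [|D [AD Dy Dz]] := separated_points gf (x := y) (y := z).
      by move=> E; apply: ij; rewrite -yi -zj E.
    exists D; split=> // t [Ct].
      by rewrite -yi => /(idxI _ _ Ct Cy) ->; apply: Dy.
    by rewrite -zj => /(idxI _ _ Ct Cz) ->; apply: Dz.
  apply/(transfer (fun p => [set y | V' p (inord (e y))])) => //.
    move=> p y Cy /=; rewrite (ec (idx y)) //; last by rewrite -ltnS.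
    by rewrite (_ : inord (idx y) = f y) //; apply: val_inj; rewrite /= inordK.
  apply: (adm_sound gf Mb) => p.
  exact: (adm_preimage gf (fun i => V' p (inord i)) eB eA).
exists (exist _ (r, f x) valid) => /=.
exists (fun p => [set j | exists2 y, C y /\ f y = j & V p y]).
move=> sa; apply: Na; apply/transfer; [|exact: Cx|exact: sa].
move=> p y Cy; split=> [Vy|[z [Cz fz]]]; first by exists y.
by rewrite (fI y z).
Qed.

End Tables.

Lemma bounded_tabular (N K : nat) :
  (forall c : nat -> W, ~ simple_path c N) ->
  (forall (x : W) (u : nat -> W), (forall i, i <= K -> clust x (u i)) ->
     ~ forall i j, i <= K -> j <= K -> u i = u j -> i = j) ->
  tabular M.
Proof.
(* A component has at most [N] clusters, each with at most [K] points. *)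
move=> bounded small; pose B := N * K.
have comp (x : W) : exists C l, [/\ forall y z, C y -> acc y z \/ acc z y -> C z,
    size l <= B, forall y, C y -> List.In y l & C x].
  have [c [n [m [cy [o [nN Cc]]]]]] := component_exists FF bounded x.
  have /choice[l lP] : forall i, exists l, size l <= K /\
      forall y, clust (c i) y -> List.In y l.
    move=> i; have [l lK lc] := finite_cover (small (c i)).
    by exists l.
  exists [set y | exists2 i, i <= n & clust (c i) y], (flatten [seq l i | i <- iota 0 n.+1]).
  split.
  - by move=> y z [i lin iy] yz; apply: (component_mem FF Cc lin iy yz).
  - apply: (@leq_trans (n.+1 * K)); last by rewrite leq_mul2r nN orbT.
    rewrite -{2}(size_iota 0 n.+1); elim: (iota 0 n.+1) => // i s IH.
    by rewrite /= size_cat mulSn leq_add //; case: (lP i).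
  - move=> y [i lin iy]; have : i \in iota 0 n.+1 by rewrite mem_iota.
    elim: (iota 0 n.+1) => // j s IH; rewrite in_cons /= => ijs.
    apply/List.in_or_app; case/orP: ijs => [/eqP <-|/IH]; last by right.
    by left; apply: (lP i).2.
  - by exists m; [exact: comp_le Cc|exact: comp_mem Cc].
(* Embedding a component on which [Bot] is refuted provides a point of the union. *)
have ht : inhabited (tables B).
  case: (world_inhabited W) => x; have [C [l [Cc lB lC Cx]]] := comp x.
  have [||t _] := table_embedding Cc lB lC Cx (V := fun _ => setT) (a := Bot).
  - by [].
  - by move=> p; apply: (admT gf).
  - by exists.
exists (Frame (@tables_acc B) ht); first exact: finite_finset.
apply/seteqP; split=> [|a La]; first exact: tables_sound.
apply: contrapT => /(adm_complete gf)[V [x [AV Na]]].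
have [C [l [Cc lB lC Cx]]] := comp x.
have [t [V' NV']] := table_embedding Cc lB lC Cx Na AV.
pose U p := [set s : tables B | exists2 j, val s = ((val t).1, j) & V' p j].
have UV (s : tables B) j p : val s = ((val t).1, j) -> U p s <-> V' p j.
  move=> sj; split=> [[j' s'j]|Vj]; last by exists j.
  by have [->] : ((val t).1, j) = ((val t).1, j') by rewrite -sj.
by apply: NV'; apply/(tables_sat (ht := ht) UV a (surjective_pairing (val t))).
Qed.

End Tabular.

(** * Soundness and S5t *)

(** [f] is the position in a garland, and [b] marks the minimal points. *)
Lemma zigzag_s4bp (F : frame) (f : F -> int) (b : F -> bool) :
  (forall x y : F, acc x y <->
     f x = f y \/ b x /\ (f y = f x + 1 \/ f x = f y + 1)%R) ->
  (forall x y, f x = f y -> b x = b y) ->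
  (forall x y, f y = (f x + 1)%R -> b y = ~~ b x) ->
  s4bp_frame F.
Proof.
move=> fz b0 b1.
have step (x y : F) : b x -> (f y = f x + 1 \/ f x = f y + 1)%R -> ~~ b y.
  by move=> bx [/b1->|/b1 E]; [rewrite bx|rewrite E in bx].
have accl (x y z : F) : f x = f y -> acc x z -> acc y z.
  by move=> E /fz H; apply/fz; rewrite -E -(b0 _ _ E).
have accr (x y z : F) : f x = f y -> acc z x -> acc z y.
  by move=> E /fz H; apply/fz; rewrite -E.
have acc_eq (x y : F) : f x = f y -> acc x y by move=> E; apply/fz; left.
pose i0 := @Ordinal 3 0 isT; pose i1 := @Ordinal 3 1 isT.
pose i2 := @Ordinal 3 2 isT.
split.
- by move=> x; apply: acc_eq.
- move=> x y z /fz[E|[bx H]]; first by move: E => /esym; apply: accl.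
  move=> /fz[E|[by_ _]]; first by apply: (accr y) => //; apply/fz; right.
  by have := step _ _ bx H; rewrite by_.
- move=> x y z /fz[E _|[bx H]]; first by left; apply: acc_eq.
  move=> /fz[E|[by_ _]]; first by right; apply: acc_eq.
  by have := step _ _ bx H; rewrite by_.
- move=> x y xy.
  have /fz[E0|[_ D0]] := xy i0.
    by exists i0, i1; split=> //; apply: accl E0 (xy i1).
  have /fz[E1|[_ D1]] := xy i1.
    by exists i1, i0; split=> //; apply: accl E1 (xy i0).
  have [E|NE] := pselect (f (y i0) = f (y i1)).
    by exists i0, i1; split=> //; apply: acc_eq.
  have /fz[E2|[_ D2]] := xy i2.
    by exists i2, i0; split=> //; apply: accl E2 (xy i0).
  have [E|E] : f (y i2) = f (y i0) \/ f (y i2) = f (y i1) by lia.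
    by exists i2, i0; split=> //; apply: acc_eq.
  by exists i2, i1; split=> //; apply: acc_eq.
- move=> x y xy.
  have /fz[/esym E0|[_ D0]] := xy i0.
    by exists i1, i0; split=> //; apply: accr E0 (xy i1).
  have /fz[/esym E1|[_ D1]] := xy i1.
    by exists i0, i1; split=> //; apply: accr E1 (xy i0).
  have [E|NE] := pselect (f (y i0) = f (y i1)).
    by exists i0, i1; split=> //; apply: acc_eq.
  have /fz[/esym E2|[_ D2]] := xy i2.
    by exists i0, i2; split=> //; apply: accr E2 (xy i0).
  have [E|E] : f (y i2) = f (y i0) \/ f (y i2) = f (y i1) by lia.
    by exists i2, i0; split=> //; apply: acc_eq.
  by exists i2, i1; split=> //; apply: acc_eq.
Qed.

Lemma RzE (i j : int) :
  Rz i j <-> i = j \/ odd `|i|%N /\ (j = i + 1 \/ i = j + 1)%R.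
Proof.
split=> [[|[k []]|[k []]]|]; [lia|lia|lia|].
case=> [->|[oi [E|E]]]; first exact: Or31.
  by apply: Or33; exists ((i - 1) %/ 2)%Z; lia.
by apply: Or32; exists (j %/ 2)%Z; lia.
Qed.

Lemma garlandZ_s4bp : s4bp_frame garlandZ.
Proof.
apply: (@zigzag_s4bp garlandZ (fun i => i) (fun i => odd `|i|%N)).
- exact: RzE.
- by move=> x y ->.
- by move=> x y; lia.
Qed.

Lemma blowup_s4bp o n (m : 'I_n.+1) : s4bp_frame (blowup (gar o n) m nat).
Proof.
apply: (@zigzag_s4bp _ (fun u => Posz (pos u)) (fun u => odd (pos u) (+) o)).
- by move=> x y; rewrite pos_acc /zig; lia.
- by move=> x y; lia.
- by move=> x y; lia.
Qed.

Lemma smallest_tense (X : set form) : tense_logic (smallest tense_logic X).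
Proof.
split.
- by move=> a ta L [LL _]; apply: (tl_taut LL).
- by move=> a b; split=> H L LX; case: (LX) => LL _; apply/(tl_adj LL); apply: (H _ LX).
- by move=> a b Ha Hab L LX; case: (LX) => LL _; apply: (tl_mp LL (Ha _ LX) (Hab _ LX)).
- by move=> s a Ha L LX; case: (LX) => LL _; apply: (tl_subst LL); apply: (Ha _ LX).
Qed.

(** * [S5t] as the logic of one infinite cluster *)

Lemma sat_S5 (F : frame) (V : nat -> set F) (x : F) :
  sat V x (Imp (Dia (Var 0)) (Box (Dia (Var 0)))) <->
  ((exists2 y, acc x y & V 0 y) ->
   forall z, acc x z -> exists2 y, acc z y & V 0 y).
Proof.
have D y := sat_dia V y (Var 0).
rewrite (_ : sat V x _ = (sat V x (Dia (Var 0)) ->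
  forall z, acc x z -> sat V z (Dia (Var 0)))) // D.
by split=> H /H xz z /xz; [apply: (D z).1|apply: (D z).2].
Qed.

Lemma S5t_sub_Log (F : frame) : s4bp_frame F ->
  (forall x y : F, acc x y -> acc y x) -> S5t `<=` Log F.
Proof.
move=> FF sym; apply: smallest_le; first exact: Log_tense.
  by apply: S4t_sound; [apply: fr_refl|apply: fr_trans].
move=> _ -> V x; apply/sat_S5 => -[y xy Vy] z xz.
by exists y => //; apply: (fr_trans FF) xy; apply: sym.
Qed.

Lemma S5t_axioms : S4t `<=` S5t /\ S5t (Imp (Dia (Var 0)) (Box (Dia (Var 0)))).
Proof. by split; [exact: oplus_left|apply: (@oplus_right S4t)]. Qed.

Lemma Log_S5t_sym (F : frame) : S5t `<=` Log F ->
  forall x y : F, acc x x -> acc x y -> acc y x.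
Proof.
move=> H x y xx xy; have /(_ (fun _ => [set x]) x)/sat_S5 := H _ S5t_axioms.2.
by case/(_ _ y xy) => [|z yz /= <-]; first by exists x.
Qed.

Lemma pos0 o (m : 'I_1) (u : blowup (gar o 0) m nat) : pos u = 0.
Proof. by have := pos_le u; lia. Qed.

Lemma acc0 o (m : 'I_1) (u v : blowup (gar o 0) m nat) : acc u v.
Proof. by apply/pos_acc; left; rewrite !pos0. Qed.

Lemma S5t_consistent : consistent S5t.
Proof.
move=> /(S5t_sub_Log (blowup_s4bp false (ord0 : 'I_1)) _) H.
by apply: (Log_consistent (H _)) => x y _; apply: acc0.
Qed.

(** Proved from the axioms of [S4t], because the inclusion of [S4BP] in [S5t], on which
    [general_frame_s4bp] would rest, is obtained through [S5t_Log]. *)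
Lemma S5t_general_frame_refl (W : frame) (A : set (set W)) :
  general_frame S5t A -> forall x : W, acc x x.
Proof.
move=> gf x; apply: contrapT => /(adm_tight gf)[E [AE Ex xE]]; apply: xE.
have := S5t_axioms.1 _ S4t_axioms.1.
by move=> /(adm_sound gf)/(_ (fun _ => E) (fun _ => AE) x); apply.
Qed.

Lemma S5t_general_frame_sym (W : frame) (A : set (set W)) :
  general_frame S5t A -> forall x y : W, acc x y -> acc y x.
Proof.
move=> gf x y xy; apply: contrapT => /(adm_tight gf)[D [AD Dy Dx]].
have xx := S5t_general_frame_refl gf x.
have /(adm_sound gf)/(_ (fun _ => ~` D) (fun _ => admC gf AD) x)/sat_S5 := S5t_axioms.2.
by case/(_ _ y xy) => [|z /Dy]; first by exists x.
Qed.

Lemma S5t_general_frame_trans (W : frame) (A : set (set W)) :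
  general_frame S5t A -> forall x y z : W, acc x y -> acc y z -> acc x z.
Proof.
move=> gf x y z xy yz; apply: contrapT => /(adm_tight gf)[E [AE Ex zE]].
apply: zE; have := S5t_axioms.1 _ S4t_axioms.2.
move=> /(adm_sound gf)/(_ (fun _ => E) (fun _ => AE) x) /= H.
exact: (H Ex y xy z yz).
Qed.

(** In the canonical frame of [S5t] accessibility is an equivalence, and the added copies [inr i]
    represent the finitely many types in the class of the refuting point. Thus [S5t] joins the
    family as its case [n = 0]. *)
Lemma S5t_Log o (m : 'I_1) : S5t = Log (blowup (gar o 0) m nat).
Proof.
apply/seteqP; split.
  by apply: S5t_sub_Log; [apply: blowup_s4bp|move=> x y _; apply: acc0].
move=> a La; apply: contrapT => Na.
have ST : tense_logic S5t by apply: smallest_tense.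
have [W [A gf]] := exists_general_frame ST S5t_consistent.
have sym := S5t_general_frame_sym gf.
have tr := S5t_general_frame_trans gf.
have [V [x [AV]]] := adm_complete gf Na; apply.
have xx := S5t_general_frame_refl gf x.
have [h [K [hS hK]]] := finite_types V (var_bound a) (S := [set y | acc x y]) xx.
pose F := blowup (gar o 0) m nat.
pose f (u : F) : W := if u is inr i then h i else x.
have xf u : acc x (f u) by case: u => //= i; apply: hS.
have := @bisim_sat W F V (fun p => [set u | V p (f u)]) (var_bound a)
  (fun _ y u => acc x y /\ forall p, p < var_bound a -> V p y <-> V p (f u)).
move=> /(_ _ _ _ a (depth a) x (inl m : F) (leqnn _) (leqnn _)) [] //.
- by move=> d y u [_ H] p /H.
- move=> d y u [xy _]; split=> [z yz|v _].
    have xz := tr _ _ _ xy yz; have [i iK zi] := hK z xz.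
    by exists (inr i); [apply: acc0|split].
  by exists (f v) => //; apply: (tr _ x) => //; apply: sym.
- move=> d y u [xy _]; split=> [z yz|v _].
    have xz := tr _ _ _ xy (sym _ _ yz); have [i iK zi] := hK z xz.
    by exists (inr i); [apply: acc0|split].
  by exists (f v) => //; apply: (sym _ _ (tr _ x _ (sym _ _ xy) _)).
- by move=> _; apply; apply: La.
Qed.

(** * Formulas separating the blown-up garlands *)

(** One step along the relation in either direction; in a reflexive frame its iterates express
    bounds on undirected distance. *)
Definition Near (a : form) : form := Or (Dia a) (PDia a).
Definition Hist (a : form) : form := Neg (PDia (Neg a)).

Fixpoint reach (F : frame) (k : nat) (x y : F) : Prop :=
  if k is k'.+1 then exists2 z, acc x z \/ acc z x & reach k' z y else x = y.

Section Reach.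
Variables (F : frame) (V : nat -> set F).

Lemma sat_near x a : sat V x (Near a) <->
  exists2 y, acc x y \/ acc y x & sat V y a.
Proof.
rewrite sat_or sat_dia /=; split.
  by case=> -[y xy ya]; exists y; auto.
by case=> y [] xy ya; [left|right]; exists y.
Qed.

Lemma sat_iter_near k x a :
  sat V x (iter k Near a) <-> exists2 y, reach k x y & sat V y a.
Proof.
elim: k x => [|k IH] x; first by split=> [|[y <-]] //; exists x.
rewrite iterS sat_near; split.
  by move=> [y xy /IH[z yz za]]; exists z => //; exists y.
by move=> [z [y xy yz] za]; exists y => //; apply/IH; exists z.
Qed.

Lemma sat_hist x a : sat V x (Hist a) <-> forall y, acc y x -> sat V y a.
Proof.
split=> [H y yx|H [y yx]]; last by apply; apply: H.
by apply: contrapT => Na; apply: H; exists y.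
Qed.

Lemma sat_everywhere k x a :
  sat V x (Neg (iter k Near (Neg a))) <-> forall y, reach k x y -> sat V y a.
Proof.
rewrite sat_neg sat_iter_near; split=> [H y xy|H [y /H ya Na]]; last exact: Na.
by apply: contrapT => Na; apply: H; exists y.
Qed.

End Reach.

(** Distance is difference of positions, except that distinct points of the fat cluster share a
    position and are one step apart; hence the clause for [k = 0]. *)
Lemma reach_pos o n (m : 'I_n.+1) k (u v : blowup (gar o n) m nat) :
  reach k u v <-> [/\ pos u <= pos v + k, pos v <= pos u + k & k = 0 -> u = v].
Proof.
elim: k u => [|k IH] u.
  rewrite addn0 addn0; split=> [/= ->|[_ _ H]]; last exact: (H erefl).
  by rewrite leqnn.
split=> [[w uw /IH[w1 w2 _]]|[h1 h2 _]].
  have : zig o (pos u) (pos w) \/ zig o (pos w) (pos u).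
    by case: uw => /pos_acc; auto.
  by rewrite /zig => H; split=> //; lia.
have [k0|k0] := eqVneq k 0.
  exists v; last by apply/IH; rewrite k0; split=> //; lia.
  by rewrite !pos_acc /zig; lia.
have [E|NE] := eqVneq (pos u) (pos v).
  exists u; first by left; apply/pos_acc; left.
  by apply/IH; split; lia.
pose p := if pos u < pos v then (pos u).+1 else (pos u).-1.
have pn : p < n.+1.
  by have := pos_le u; have := pos_le v; rewrite /p; case: ifP; lia.
have [w wE] : exists w : blowup (gar o n) m nat, pos w = p.
  by exists (inl (Ordinal pn)).
exists w; first by rewrite !pos_acc wE /zig /p; case: ifP; lia.
by apply/IH; rewrite wE /p; split=> [||k']; [case: ifP; lia|case: ifP; lia|lia].
Qed.

Lemma reach_garlandZ k (i j : garlandZ) : reach k i j ->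
  (i <= j + Posz k /\ j <= i + Posz k)%R.
Proof.
elim: k i => [|k IH] i /=; first by move=> ->; lia.
case=> z iz /IH; have : Rz i z \/ Rz z i by [].
by rewrite !RzE; lia.
Qed.

Lemma garlandZ_reach (i : nat) : reach i (0%R : garlandZ) (Posz i).
Proof.
suff H k j : reach k (Posz j : garlandZ) (Posz (j + k)) by have := H i 0.
elim: k j => [|k IH] j /=; first by rewrite addn0.
exists (Posz j.+1); last by have := IH j.+1; rewrite addSnnS.
by have : Rz (Posz j) (Posz j.+1) \/ Rz (Posz j.+1) (Posz j) by rewrite !RzE; lia.
Qed.

Lemma sat_box (F : frame) (V : nat -> set F) (x : F) a :
  sat V x (Box a) <-> forall y, acc x y -> sat V y a.
Proof. by []. Qed.

(** Satisfiable in a blown-up garland if and only if its fat cluster is maximal,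
    respectively minimal. *)
Definition top_fat : form := Box (And (Dia (Var 0)) (Dia (Neg (Var 0)))).
Definition bot_fat : form := Hist (And (PDia (Var 0)) (PDia (Neg (Var 0)))).

Lemma sat_top_fat (F : frame) (V : nat -> set F) (x : F) : sat V x top_fat <->
  forall y, acc x y -> (exists2 z, acc y z & V 0 z) /\ (exists2 z, acc y z & ~ V 0 z).
Proof.
by rewrite sat_box; split=> H y xy; have := H y xy; rewrite sat_and !sat_dia.
Qed.

Lemma sat_bot_fat (F : frame) (V : nat -> set F) (x : F) : sat V x bot_fat <->
  forall y, acc y x -> (exists2 z, acc z y & V 0 z) /\ (exists2 z, acc z y & ~ V 0 z).
Proof.
by rewrite sat_hist; split=> H y xy; have := H y xy; rewrite sat_and.
Qed.

(** Above every point lies a maximal point seeing only itself, and below it a minimal point seen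
    only from itself; no such point can have witnesses for both [Var 0] and its negation. *)
Lemma garlandZ_thin (V : nat -> set garlandZ) (x : garlandZ) :
  ~ sat V x top_fat /\ ~ sat V x bot_fat.
Proof.
have acE (y z : garlandZ) : acc y z <-> _ := RzE y z.
split.
  move=> /sat_top_fat H; pose y : garlandZ := if odd `|x|%N then (x + 1)%R else x.
  have yE z : acc y z -> z = y by rewrite acE /y; case: ifP; lia.
  have xy : acc x y by rewrite acE /y; case: ifP; lia.
  by have [[z /yE-> Vy] [t /yE->]] := H y xy.
move=> /sat_bot_fat H; pose y : garlandZ := if odd `|x|%N then x else (x + 1)%R.
have yE z : acc z y -> z = y by rewrite acE /y; case: ifP; lia.
have yx : acc y x by rewrite acE /y; case: ifP; lia.
by have [[z /yE-> Vy] [t /yE->]] := H y yx.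
Qed.

Lemma pos_inj o n (m : 'I_n.+1) (u v : blowup (gar o n) m nat) :
  pos u = pos v -> pos u <> m -> u = v.
Proof.
case: u v => [i|i] [j|j]; rewrite /pos /= => E H; by [rewrite (val_inj E)|case: H].
Qed.

Section FatCluster.
Variables (o : bool) (n : nat) (m : 'I_n.+1).
Local Notation F := (blowup (gar o n) m nat).

Lemma exists_pos (p : nat) : p <= n -> exists u : F, pos u = p.
Proof. by rewrite -ltnS => pn; exists (inl (Ordinal pn)). Qed.

Lemma top_fat_sat : odd m (+) o = false ->
  sat (fun _ => [set (inl m : F)]) (inl m : F) top_fat.
Proof.
move=> mo; apply/sat_top_fat => y /pos_acc my.
have ym : pos y = m by move: my; rewrite /zig (_ : pos (inl m : F) = m) // mo; lia.
split; first by exists (inl m) => //; apply/pos_acc; left.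
by exists (inr 0) => //; apply/pos_acc; left.
Qed.

Lemma bot_fat_sat : odd m (+) o \/ n = 0 ->
  sat (fun _ => [set (inl m : F)]) (inl m : F) bot_fat.
Proof.
move=> mo; apply/sat_bot_fat => y /pos_acc my.
have ym : pos y = m.
  by have := pos_le y; have := ltn_ord m; move: my mo;
    rewrite /zig (_ : pos (inl m : F) = m) //; lia.
split; first by exists (inl m) => //; apply/pos_acc; left.
by exists (inr 0) => //; apply/pos_acc; left.
Qed.

Lemma bot_thin (y z : F) : odd m (+) o = false -> odd (pos y) (+) o ->
  acc z y -> z = y.
Proof.
move=> mo yo /pos_acc; rewrite /zig => H; apply: pos_inj; first lia.
by move=> zm; move: mo yo H; rewrite zm; lia.
Qed.

Lemma bot_fat_unsat (V : nat -> set F) (x : F) :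
  odd m (+) o = false -> 0 < n -> ~ sat V x bot_fat.
Proof.
move=> mo n0 /sat_bot_fat H.
have [y yx yo] : exists2 y : F, acc y x & odd (pos y) (+) o.
  have [xo|xo] := boolP (odd (pos x) (+) o).
    by exists x => //; apply/pos_acc; left.
  have pn : (if pos x == n then (pos x).-1 else (pos x).+1) <= n.
    by have := pos_le x; case: ifP; lia.
  have [y yE] := exists_pos pn.
  by exists y; [apply/pos_acc; rewrite /zig|]; move: yE xo; case: ifP; lia.
by have [[z /bot_thin-> // Vy] [t /bot_thin-> //]] := H y yx.
Qed.

(** [top_fat] can also hold at a minimal point whose only neighbour is the fat cluster. The second
    conjunct excludes this, as such a point has no predecessor but itself. *)
Definition core : form := And top_fat (And (Var 1) (PDia (Neg (Var 1)))).

Lemma sat_core (V : nat -> set F) (x : F) : sat V x core <->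
  [/\ sat V x top_fat, V 1 x & exists2 y, acc y x & ~ V 1 y].
Proof. by rewrite !sat_and; split=> [[? []]|[]]. Qed.

Lemma core_pos (V : nat -> set F) (x : F) :
  odd m (+) o = false -> sat V x core -> pos x = m.
Proof.
move=> mo /sat_core[/sat_top_fat tx Vx [y yx Vy]]; apply: contrapT => xm.
have [xo|xo] := boolP (odd (pos x) (+) o).
  by move: Vy; rewrite (bot_thin mo xo yx).
have xE z : acc x z -> z = x.
  by move=> /pos_acc xz; apply/esym/pos_inj => //; move: xz xo; rewrite /zig; lia.
have [|[z /xE-> Vz] [t /xE->]] // := tx x.
by apply/pos_acc; left.
Qed.

End FatCluster.

(** Around the fat cluster, [sep a b] requires that every point is within
    distance [b] of it, and within distance [a] of it or within distance
    [b - a - 1] of a point marked by [Var 2], which is not within distance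
    [b - 1] of the cluster. With the fat cluster maximal and [a < b], this
    bounds the lengths of the two arms by [a] and [b]. *)
Definition sep (a b N : nat) : form :=
  let all f := Neg (iter N Near (Neg f)) in
  And (Box core) (And
    (all (Or (iter a Near core) (iter (b - a - 1) Near (Var 2)))) (And
    (all (iter b Near core))
    (all (Imp (Var 2) (Neg (iter (b - 1) Near core)))))).

Lemma sat_sep (F : frame) (V : nat -> set F) (x : F) a b N :
  sat V x (sep a b N) <->
  [/\ forall y, acc x y -> sat V y core,
      forall y, reach N x y -> (exists2 z, reach a y z & sat V z core) \/
        (exists2 z, reach (b - a - 1) y z & V 2 z),
      forall y, reach N x y -> exists2 z, reach b y z & sat V z core &
      forall y, reach N x y -> V 2 y ->
        ~ exists2 z, reach (b - 1) y z & sat V z core].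
Proof.
rewrite /sep !sat_and !sat_everywhere sat_box; split.
  move=> [H1 [H2 [H3 H4]]]; split=> // y /[dup] xy.
  - by move=> /H2/sat_or[] /sat_iter_near; [left|right].
  - by move=> /H3/sat_iter_near.
  - by move=> /H4 H Vy /sat_iter_near; apply: H.
move=> [H1 H2 H3 H4]; split=> //; split; [|split] => y xy.
- by apply/sat_or; have [H|H] := H2 y xy; [left|right]; apply/sat_iter_near.
- exact/sat_iter_near/H3.
- by move=> Vy /sat_iter_near; apply: H4.
Qed.

Section Sep.
Variables (o : bool) (n : nat) (m : 'I_n.+1).
Local Notation F := (blowup (gar o n) m nat).
Hypothesis mo : odd m (+) o = false.

Lemma sep_sat N : 2 * m < n ->
  exists (V : nat -> set F) x, sat V x (sep m (n - m) N).
Proof.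
(* [Var 0] splits the fat cluster, [Var 1] marks it, and [Var 2] marks the end of the longer arm. *)
move=> mn; pose V (p : nat) : set F := nth set0 [:: [set (inl m : F)];
  [set u : F | pos u = m]; [set u : F | pos u = n]] p.
have coreE u : sat V u core <-> pos u = m.
  split=> [/sat_core[]//|um]; apply/sat_core; split=> //.
    apply/sat_top_fat => y /pos_acc uy.
    have ym : pos y = m by move: uy; rewrite /zig um mo; lia.
    split; first by exists (inl m) => //; apply/pos_acc; left.
    by exists (inr 0) => //; apply/pos_acc; left.
  have [y yE] := @exists_pos o n m m.+1 ltac:(lia).
  exists y; first by apply/pos_acc; rewrite um yE /zig; lia.
  by rewrite /V /= yE; lia.
have [c cE] := @exists_pos o n m m ltac:(lia).
have [t tE] := @exists_pos o n m n (leqnn _).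
exists V, c; apply/sat_sep; split.
- move=> y /pos_acc; rewrite cE => cy; apply/coreE.
  by move: cy; rewrite /zig mo; lia.
- move=> y _; have yn := pos_le y.
  have [le|lt] := leqP (pos y) (2 * m).
    left; have [y_m|y_m] := eqVneq (pos y) m.
      by exists y; [apply/reach_pos; split=> //; lia|apply/coreE].
    by exists c; [apply/reach_pos; rewrite cE; split; lia|apply/coreE].
  right; have [y_n|y_n] := eqVneq (pos y) n.
    by exists y => //; apply/reach_pos; split=> //; lia.
  exists t => //; apply/reach_pos; rewrite tE; split; lia.
- move=> y _; have yn := pos_le y; exists c; last exact/coreE.
  by apply/reach_pos; rewrite cE; split; lia.
- move=> y _ /= yn [z /reach_pos[z1 z2 _] /coreE zm].
  by move: z1 z2; rewrite zm (yn : pos y = n); lia.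
Qed.

(** Were [a < m], the end of the shorter arm would need a point marked by [Var 2] within
    [b - a - 1]. Since [m < n - m <= b], that point would be within [b - 1] of the cluster, which
    [sep] forbids. *)
Lemma sep_unsat (V : nat -> set F) (x : F) (a b N : nat) :
  n < N -> 2 * m < n -> a < b -> sat V x (sep a b N) -> m <= a /\ n - m <= b.
Proof.
move=> nN mn ab /sat_sep[cx H1 H2 H3].
have xm : pos x = m by apply: core_pos mo (cx x _); apply/pos_acc; left.
have coreE u : sat V u core <-> pos u = m.
  split; first exact: core_pos.
  by move=> um; apply: cx; apply/pos_acc; rewrite um xm; left.
have all u : reach N x u.
  by apply/reach_pos; have := pos_le x; have := pos_le u; split; lia.
have [u0 u0E] := @exists_pos o n m 0 (leq0n _).
have [un unE] := @exists_pos o n m n (leqnn _).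
have bn : n - m <= b.
  by have [z /reach_pos[z1 z2 _] /coreE zm] := H2 un (all un); move: z1 z2; lia.
split=> //; have [[z /reach_pos[z1 z2 _] /coreE zm]|] := H1 u0 (all u0).
  by move: z1 z2; lia.
move=> [z /reach_pos[z1 z2 _] Vz].
apply: contrapT => am; apply: (H3 z (all z) Vz).
by exists x; last exact/coreE; apply/reach_pos; split; lia.
Qed.

End Sep.

(** * Incomparability and non-tabularity *)

(** Exchanging future and past transports inclusions of logics to the inverse frames, so that only a
    maximal fat cluster has to be compared in detail. *)
Fixpoint dual (a : form) : form :=
  match a with
  | Imp b c => Imp (dual b) (dual c)
  | Box b => Hist (dual b)
  | PDia b => Dia (dual b)
  | _ => a
  end.

Lemma sat_dual (F : frame) (V : nat -> set F) (x : F) a :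
  sat V x (dual a) <-> sat (F := inverse F) V x a.
Proof.
elim: a x => [p||b IHb c IHc|b IH|b IH] x; rewrite ?sat_hist ?sat_dia //=.
- by rewrite IHb IHc.
- by split=> H y xy; apply/IH/H.
- by split=> -[y xy H]; exists y => //; apply/IH.
Qed.

Lemma Log_inverse_sub (F G : frame) :
  Log F `<=` Log G -> Log (inverse F) `<=` Log (inverse G).
Proof.
move=> FG a Fa V x; have: Log G (dual a).
  by apply: FG => U y; apply/sat_dual/Fa.
by move=> /(_ V x)/sat_dual.
Qed.

Notation gar_log o n m := (Log (blowup (gar o n) m nat)).

Lemma gar_log_inverse o n (m : 'I_n.+1) o' n' (m' : 'I_n'.+1) :
  gar_log o n m `<=` gar_log o' n' m' ->
  gar_log (~~ o) n m `<=` gar_log (~~ o') n' m'.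
Proof. by move=> /Log_inverse_sub; case: o; case: o'. Qed.

Lemma Log_sub_sat (F G : frame) a : Log F `<=` Log G ->
  (exists V x, @sat G V x a) -> exists V x, @sat F V x a.
Proof.
move=> FG [V [x Gx]]; apply: contrapT => N.
by apply: (FG (Neg a) _ V x Gx) => U y Fy; apply: N; exists U, y.
Qed.

(** A test of length: it is satisfiable only if some point is reached in [k.+1] steps but not in
    [k]. *)
Lemma diameter_sat k (F : frame) (V : nat -> set F) (x : F) :
  sat V x (And (iter k.+1 Near (Var 0)) (Neg (iter k Near (Var 0)))) <->
  (exists2 y, reach k.+1 x y & V 0 y) /\ ~ (exists2 y, reach k x y & V 0 y).
Proof. by rewrite sat_and sat_neg !sat_iter_near. Qed.

Lemma gar_log_diameter k o n (m : 'I_n.+1) : 0 < k -> n <= k ->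
  ~ exists V (x : blowup (gar o n) m nat),
    sat V x (And (iter k.+1 Near (Var 0)) (Neg (iter k Near (Var 0)))).
Proof.
move=> k0 nk [V [x /diameter_sat[[y _ Vy]]]]; apply; exists y => //.
by apply/reach_pos; have := pos_le x; have := pos_le y; split; lia.
Qed.

Lemma gar_log_sub_Ga o n (m : 'I_n.+1) : ~ (gar_log o n m `<=` Ga).
Proof.
(* [n.+1] in place of [n] keeps the number of steps positive for [n = 0], where distinct points of
   the cluster are one step apart. *)
move=> /(@Log_sub_sat _ _ (And (iter n.+2 Near (Var 0)) (Neg (iter n.+1 Near (Var 0))))).
case; last by move=> V Vx; apply: (@gar_log_diameter n.+1 o n m) => //; exists V.
exists (fun _ => [set Posz n.+2]), 0%R; apply/diameter_sat; split.
  by exists (Posz n.+2) => //; apply: garlandZ_reach.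
by move=> [y /reach_garlandZ H /= E]; move: H; rewrite E; lia.
Qed.

Lemma Ga_sub_gar_log o n (m : 'I_n.+1) : ~ (Ga `<=` gar_log o n m).
Proof.
move=> H; have [mo|mo] := boolP (odd m (+) o).
  have [|V [x]] := @Log_sub_sat _ _ bot_fat H; last exact: (garlandZ_thin V x).2.
  by do 2 eexists; apply: bot_fat_sat; left.
have [|V [x]] := @Log_sub_sat _ _ top_fat H; last exact: (garlandZ_thin V x).1.
by do 2 eexists; apply: top_fat_sat; apply/negbTE.
Qed.

(** What is satisfiable in the second frame is so in the first. Thus [bot_fat] makes the second fat
    cluster maximal, the test of length gives [n' <= n], and [sep] gives [m <= m'] and
    [n - m <= n' - m']; together these force equality. *)
Lemma gar_log_antichain_top o n (m : 'I_n.+1) o' n' (m' : 'I_n'.+1) :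
  odd m (+) o = false -> 2 * m < n -> 2 * m' < n' \/ n' = 0 ->
  gar_log o n m `<=` gar_log o' n' m' -> [/\ o = o', n = n' & m = m' :> nat].
Proof.
move=> mo mn Hm' sub.
have m'o' : ~ (odd m' (+) o' \/ n' = 0).
  move=> H; have [|V [x]] := @Log_sub_sat _ _ bot_fat sub.
    by do 2 eexists; apply: bot_fat_sat.
  by apply: bot_fat_unsat => //; lia.
have {}m'o' : odd m' (+) o' = false /\ 2 * m' < n' by lia.
have [{}m'o' m'n'] := m'o'.
have n'n : n' <= n.
  rewrite leqNgt; apply/negP => nn'.
  have [|V Vx] := @Log_sub_sat _ _
      (And (iter n.+1 Near (Var 0)) (Neg (iter n Near (Var 0)))) sub; last first.
    by apply: (@gar_log_diameter n o n m); [lia|lia|exists V].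
  have [u uE] := @exists_pos o' n' m' 0 (leq0n _).
  have [v vE] := @exists_pos o' n' m' n.+1 nn'.
  exists (fun _ => [set v]), u; apply/diameter_sat; split.
    by exists v => //; apply/reach_pos; rewrite uE vE; split; lia.
  by move=> [w /reach_pos[_ H _] /= wv]; move: H; rewrite wv uE vE; lia.
have [|V [x]] := @Log_sub_sat _ _ (sep m' (n' - m') n.+1) sub.
  exact: sep_sat.
move=> /(sep_unsat mo)[||| mm' nm]; [lia|lia|lia|].
have mE : m = m' :> nat by lia.
split=> //; [rewrite mE in mo|lia].
by rewrite -[o](addKb (odd m')) mo -[o'](addKb (odd m')) m'o'.
Qed.

Lemma gar_log_antichain o n (m : 'I_n.+1) o' n' (m' : 'I_n'.+1) :
  2 * m < n \/ n = 0 -> 2 * m' < n' \/ n' = 0 ->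
  gar_log o n m `<=` gar_log o' n' m' -> gar_log o n m = gar_log o' n' m'.
Proof.
move=> [mn|n0] Hm' sub.
  suff [Eo En Em] : [/\ o = o', n = n' & m = m' :> nat].
    rewrite -{}Eo in sub *; case: n' / En m' Em Hm' sub => m' /val_inj <-.
    by [].
  have [mo|mo] := boolP (odd m (+) o); last first.
    by apply: gar_log_antichain_top sub => //; apply/negbTE.
  have [||||Eo En Em] // := @gar_log_antichain_top (~~ o) n m (~~ o') n' m'.
  - by lia.
  - exact: gar_log_inverse.
  - by split=> //; apply: negb_inj.
have [n'0|n'0] := eqVneq n' 0.
  by move: m m' {Hm' sub}; rewrite n0 n'0 => m m'; rewrite -!S5t_Log.
(* The frame would have to be symmetric, but positions 0 and 1 are related in one direction only. *)
move: m sub; rewrite n0 => m; rewrite -S5t_Log => /Log_S5t_sym sym.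
have [x xE] := @exists_pos o' n' m' 0 (leq0n _).
have [y yE] := @exists_pos o' n' m' 1 ltac:(lia).
have refl (z : blowup (gar o' n') m' nat) : acc z z by apply/pos_acc; left.
have [] : acc x y \/ acc y x by rewrite !pos_acc /zig; lia.
  move=> /[dup] xy /(sym _ _ (refl _)) yx; move: xy yx.
  by rewrite !pos_acc /zig; lia.
move=> /[dup] xy /(sym _ _ (refl _)) yx; move: xy yx.
by rewrite !pos_acc /zig; lia.
Qed.

(** * Formulas that count points *)

Definition exactly (K i : nat) : form :=
  And (Var i) (\big[And/Top]_(j < K.+1 | val j != i) Neg (Var j)).

Fixpoint walk (K i d : nat) : form :=
  if d is d'.+1 then And (exactly K i) (Near (walk K i.+1 d')) else exactly K i.

Lemma sat_exactly (F : frame) (V : nat -> set F) (x : F) K i :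
  sat V x (exactly K i) <-> V i x /\ forall j, j <= K -> j <> i -> ~ V j x.
Proof.
rewrite /exactly sat_and sat_big_and Forall_index_enum.
split=> -[Vi H]; split=> // j.
  by move=> jK ji; apply: (H (Ordinal (jK : j < K.+1))); apply/eqP.
by move=> /eqP ji; apply: H => //; rewrite -ltnS.
Qed.

Lemma walk_sat (F : frame) (w : nat -> F) K :
  (forall i j, i <= K -> j <= K -> w i = w j -> i = j) ->
  (forall i, i < K -> acc (w i) (w i.+1) \/ acc (w i.+1) (w i)) ->
  sat (fun p => [set w p]) (w 0) (walk K 0 K).
Proof.
move=> winj wacc.
suff H d i : i + d <= K -> sat (fun p => [set w p]) (w i) (walk K i d) by exact: H.
have ex i' : i' <= K -> sat (fun p => [set w p]) (w i') (exactly K i').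
  by move=> iK; apply/sat_exactly; split=> // j jK ji /= /(winj _ _ iK jK)/esym.
elim: d i => [|d IH] i idK; first by apply: ex; lia.
apply/sat_and; split; first by apply: ex; lia.
by apply/sat_near; exists (w i.+1); [apply: wacc|apply: IH]; lia.
Qed.

Lemma walk_points (F : frame) (V : nat -> set F) (x : F) K d i :
  sat V x (walk K i d) ->
  forall j, i <= j <= i + d -> exists y, sat V y (exactly K j).
Proof.
elim: d i x => [|d IH] i x.
  by move=> Vx j ij; exists x; have -> : j = i by lia.
move=> /(sat_and V x (exactly K i) (Near (walk K i.+1 d))).
move=> [Vx /sat_near[y _ /IH H]] j ij.
have [->|ji] := eqVneq j i; first by exists x.
by apply: H; lia.
Qed.

(** [walk K 0 K] requires [K.+1] points, each marked by its own variable alone, so no frame with [K]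
    points satisfies it. A walk is used so that a single point can speak of all of them. *)
Lemma Log_not_tabular (F : frame) :
  (forall K, exists w : nat -> F,
     (forall i j, i <= K -> j <= K -> w i = w j -> i = j) /\
     (forall i, i < K -> acc (w i) (w i.+1) \/ acc (w i.+1) (w i))) ->
  ~ tabular (Log F).
Proof.
move=> walks [G [K GK] E].
have [w [winj wacc]] := walks K.
have [||V [x]] := @Log_sub_sat G F (walk K 0 K); first by rewrite E.
  by do 2 eexists; apply: walk_sat winj wacc.
move=> /walk_points H.
have /choice[y yP] : forall i, exists y, i <= K -> sat V y (exactly K i).
  move=> i; have [iK|iK] := leqP i K; last by exists x.
  by have [|y Vy] := H i; [lia|exists y].
have yinj i j : i <= K -> j <= K -> y i = y j -> i = j.
  move=> iK jK yij; apply: contrapT => ij.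
  have /sat_exactly[_ /(_ _ jK (nesym ij))] := yP i iK; apply.
  by rewrite yij; have /sat_exactly[] := yP j jK.
have yin : {in `I_K.+1 &, injective y}.
  by move=> i j /set_mem/= iK /set_mem/= jK; apply: yinj.
have : (`I_K.+1 #<= `I_K)%card.
  rewrite -(card_le_eql (inj_card_eq yin)) -(card_le_eqr GK).
  exact: subset_card_le.
by rewrite card_le_II ltnn.
Qed.

(** * Pretabular logics *)

Lemma gar_log_not_tabular o n (m : 'I_n.+1) : ~ tabular (gar_log o n m).
Proof.
apply: Log_not_tabular => K; exists (fun i => inr i); split=> [i j _ _ []|i _] //.
by left; apply/pos_acc; left.
Qed.

Lemma Ga_not_tabular : ~ tabular Ga.
Proof.
apply: Log_not_tabular => K; exists (fun i => Posz i); split=> [i j _ _ []|i _] //.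
suff: Rz (Posz i) (Posz i.+1) \/ Rz (Posz i.+1) (Posz i) by [].
by rewrite !RzE; lia.
Qed.

Lemma sub_Ga_or_gar_log (M : set form) : tense_logic M -> S4BP `<=` M ->
  consistent M -> ~ tabular M ->
  M `<=` Ga \/ exists o n (m : 'I_n.+1), (2 * m < n \/ n = 0) /\
    M `<=` gar_log o n m.
Proof.
move=> MT ML Mc Mt; have [W [A gf]] := exists_general_frame MT Mc.
have [long|] := pselect (forall n, exists c : nat -> W, simple_path c n).
  by left; apply: (long_paths_sub_Ga gf ML).
move=> /existsNP[N /forallNP bounded]; right.
apply: (bounded_paths_sub gf ML bounded); apply: contrapT => /existsNP[K small].
apply/Mt/(bounded_tabular MT gf ML bounded (K := K)) => x u xu uinj.
by apply: small; exists x, u.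
Qed.

Lemma S4BP_sub_gar_log o n (m : 'I_n.+1) : S4BP `<=` gar_log o n m.
Proof. exact/S4BP_sound/blowup_s4bp. Qed.

(** A non-tabular proper extension of a member of [P] would lie below another
    member, so members of [P] are pretabular. *)
Lemma PTAB_antichain (L0 : set form) (P : set (set form)) :
  (forall L, P L -> [/\ tense_logic L, L0 `<=` L, consistent L & ~ tabular L]) ->
  (forall L L', P L -> P L' -> L `<=` L' -> L = L') ->
  (forall M, tense_logic M -> L0 `<=` M -> consistent M -> ~ tabular M ->
     exists2 L, P L & M `<=` L) ->
  PTAB L0 = P.
Proof.
move=> PL anti below; apply/seteqP; split=> [M [MT ML [Mc Mt Mext]]|L /[dup] LP].
  have [L LP ML'] := below M MT ML Mc Mt; have [LT LL Lc Lt] := PL L LP.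
  have [LM|LM] := pselect (L `<=` M); first by have -> : M = L by apply/seteqP.
  by case: Lt; apply: Mext.
move=> /PL[LT LL Lc Lt]; split=> //; split=> // L' L'T [LL' L'L] L'c.
apply: contrapT => L't.
have [L'' L''P L'L''] := below L' L'T (subset_trans LL LL') L'c L't.
apply: L'L; rewrite (anti L L'') //; exact: subset_trans L'L''.
Qed.

Theorem theorem7p11 :
  PTAB S4BP =
    [set Ga; S5t] `|`
    [set L | exists (n : nat) (m : 'I_n.+1),
       [/\ (0 < n)%N, (2 * m < n)%N &
           L = Log (blowup (garland n) m nat) \/
           L = Log (blowup (inverse (garland n)) m nat)]].
Proof.
(* With [S5t] as the case [n = 0] and the orientation as a parameter, everything but [Ga] becomes
   one family. *)
have -> : [set Ga; S5t] `|`
    [set L | exists (n : nat) (m : 'I_n.+1),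
       [/\ (0 < n)%N, (2 * m < n)%N &
           L = Log (blowup (garland n) m nat) \/
           L = Log (blowup (inverse (garland n)) m nat)]] =
    [set L | L = Ga \/ exists o n (m : 'I_n.+1),
       (2 * m < n \/ n = 0) /\ L = gar_log o n m].
  apply/seteqP; split=> L.
    case=> [[->|->]|[n [m [n0 mn [->|->]]]]].
    - by left.
    - right; exists false, 0, ord0; split; first by right.
      exact: S5t_Log.
    - by right; exists false, n, m; split; [left|].
    - by right; exists true, n, m; split; [left|].
  case=> [->|[o [n [m [[mn|n0] ->]]]]]; first by left; left.
    right; exists n, m; split=> //; first by lia.
    by case: o; [right|left].
  left; right; move: m; rewrite n0 => m; exact/esym/S5t_Log.
apply: PTAB_antichain.
- move=> _ [->|[o [n [m [_ ->]]]]].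
    split; [exact: Log_tense|exact/S4BP_sound/garlandZ_s4bp
      |exact: Log_consistent|exact: Ga_not_tabular].
  split; [exact: Log_tense|exact: S4BP_sub_gar_log|exact: Log_consistent
    |exact: gar_log_not_tabular].
- move=> _ _ [->|[o [n [m [mn ->]]]]] [->|[o' [n' [m' [mn' ->]]]]] //.
  + by move=> /Ga_sub_gar_log.
  + by move=> /gar_log_sub_Ga.
  + exact: gar_log_antichain.
- move=> M MT ML Mc Mt.
  have [MG|[o [n [m [mn MG]]]]] := sub_Ga_or_gar_log MT ML Mc Mt.
    by exists Ga; [left|].
  by exists (gar_log o n m) => //; right; exists o, n, m.
Qed.
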